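(* Let $F$ be a finitely generated free group of rank $k\ge 2$. Then for any free basis $A$ of $F$ there exists an automorphism $\phi$ of $F$ such that $\lambda_A(\phi)\ne\lambda_A(\phi^{-1})$.
   Context: For a free basis $A$ of $F$, identify $\partial F$ with the set of semi-infinite freely reduced words over $A$. The uniform measure $m_A$ is the Borel probability measure on $\partial F$ that assigns mass $\frac{1}{2k(2k-1)^{|v|-1}}$ to the set of all semi-infinite reduced words with initial segment $v$, for every nonempty freely reduced word $v$ over $A$. For $\zeta\in\partial F$ and $n\ge0$, $\zeta_A(n)\in F$ denotes the element given by the initial segment of $\zeta$ of length $n$. $\ell_A(g)$ is the cyclically reduced length of $g\in F$ with respect to $A$. For $\phi\in Aut(F)$ the generic stretching factor $\lambda_A(\phi)$ is the unique number such that $$\lim_{n\to\infty}\frac{\ell_A(\phi(\zeta_A(n)))}{n}=\lambda_A(\phi)\quad\text{for } m_A\text{-a.e. }\zeta\in\partial F;$$ such a number is known to exist, and it is positive. *)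

(* Defs.v *)
From HB Require Import structures.
From mathcomp Require Import all_boot all_order all_algebra.
From mathcomp Require Import all_classical all_reals all_analysis.
From mathcomp Require Import measurable_realfun.
From mathcomp Require Import lra.

Set Implicit Arguments.
Unset Strict Implicit.
Unset Printing Implicit Defensive.

Import Order.TTheory GRing.Theory Num.Theory.
Import numFieldNormedType.Exports.

Local Open Scope classical_set_scope.
Local Open Scope ring_scope.

(* The letter (i, false) stands for the i-th basis element and (i, true) for
   its inverse. *)
Notation letter k := ('I_k * bool)%type.

Definition linv k (x : letter k) : letter k := (x.1, ~~ x.2).

Definition reduced k (w : seq (letter k)) : bool :=
  sorted (fun x y => y != linv x) w.

Definition letter_val (F : groupType) k (A : 'I_k -> F) (x : letter k) : F :=
  if x.2 then ((A x.1)^-1)%g else A x.1.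

Definition word_val (F : groupType) k (A : 'I_k -> F) (w : seq (letter k)) : F :=
  (\prod_(x <- w) letter_val A x)%g.

Definition free_basis (F : groupType) k (A : 'I_k -> F) : Prop :=
  forall g : F, exists! w : seq (letter k), reduced w /\ word_val A w = g.

Definition reduced_form (F : groupType) k (A : 'I_k -> F) (g : F) :
    seq (letter k) :=
  xget [::] [set w | reduced w /\ word_val A w = g].

Section free_basis_lift.
Variable k : nat.
Implicit Types (x : letter k) (w : seq (letter k)).

Let push x w := if w is y :: s then if y == linv x then s else x :: w else [:: x].

Let reduced_push x w : reduced w -> reduced (push x w).
Proof.
case: w => //= y s ys; case: eqP => [_|/eqP xy]; last by rewrite /reduced /= xy.
exact: path_sorted ys.
Qed.

Lemma letter_valV (F : groupType) (A : 'I_k -> F) x :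
  letter_val A (linv x) = ((letter_val A x)^-1)%g.
Proof. by rewrite /letter_val /=; case: x.2 => //=; rewrite invgK. Qed.

Let word_val_push (F : groupType) (A : 'I_k -> F) x w :
  word_val A (push x w) = (letter_val A x * word_val A w)%g.
Proof.
rewrite /word_val; case: w => [|y s] /=; first by rewrite big_seq1 big_nil mulg1.
case: eqP => [->|_]; last by rewrite [LHS]big_cons.
by rewrite big_cons letter_valV mulVKg.
Qed.

Let reduce w := foldr push [::] w.

Let reduced_reduce w : reduced (reduce w).
Proof. by elim: w => //= x w; exact: reduced_push. Qed.

Let word_val_reduce (F : groupType) (A : 'I_k -> F) w :
  word_val A (reduce w) = word_val A w.
Proof.
elim: w => //= x w IH.
by rewrite word_val_push IH /word_val big_cons.
Qed.

Lemma word_val_cat (F : groupType) (A : 'I_k -> F) w1 w2 :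
  word_val A (w1 ++ w2) = (word_val A w1 * word_val A w2)%g.
Proof. by rewrite /word_val big_cat. Qed.

Lemma reduced_formP (F : groupType) (A : 'I_k -> F) (g : F) : free_basis A ->
  reduced (reduced_form A g) /\ word_val A (reduced_form A g) = g.
Proof.
move=> /(_ g) [w [wP _]]; rewrite /reduced_form.
by case: xgetP => [y _ //|/(_ w)]; case.
Qed.

Lemma reduced_form_eq (F : groupType) (A : 'I_k -> F) w : free_basis A ->
  reduced w -> reduced_form A (word_val A w) = w.
Proof.
move=> hA rw; have [u [_ uP]] := hA (word_val A w).
by rewrite -(uP _ (reduced_formP (word_val A w) hA)) -(uP w).
Qed.

Lemma free_basis_lift (F G : groupType) (A : 'I_k -> F) (f : 'I_k -> G) :
  free_basis A ->
  exists2 phi : {multiplicative F -> G}, forall i, phi (A i) = f i &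
    forall psi : {multiplicative F -> G},
      (forall i, psi (A i) = f i) -> psi =1 phi.
Proof.
move=> hA; pose h g := word_val f (reduced_form A g).
have hw w : h (word_val A w) = word_val f w.
  rewrite /h -(word_val_reduce A) reduced_form_eq ?word_val_reduce //.
have hM : {morph h : x y / (x * y)%g}.
  move=> x y; have [_ <-] := reduced_formP x hA; have [_ <-] := reduced_formP y hA.
  by rewrite -word_val_cat !hw word_val_cat.
pose phi : {multiplicative F -> G} :=
  HB.pack h (isMultiplicative.Build F G h hM).
exists phi => [i|psi psiP g].
  have := hw [:: (i, false)]; rewrite /word_val !big_seq1; exact.
have psi1 : psi 1%g = 1%g.
  by apply: (mulgI (psi 1%g)); rewrite -gmulfM !mulg1.
have psiV (x : F) : psi (x^-1)%g = ((psi x)^-1)%g.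
  by apply: (mulgI (psi x)); rewrite -gmulfM !mulgV.
rewrite /= /h -{1}(reduced_formP g hA).2.
elim: (reduced_form A g) => [|[i b] w IH]; first by rewrite /word_val !big_nil.
rewrite /word_val !big_cons gmulfM; congr (_ * _)%g; last exact: IH.
by rewrite /letter_val /=; case: b; rewrite ?psiV psiP.
Qed.

End free_basis_lift.

(* Repeatedly deletes a first letter and a last letter that are inverse to each
   other; n bounds the number of steps. *)
Fixpoint cyclic_reduction_rec k (n : nat) (w : seq (letter k)) :=
  match n, w with
  | n'.+1, x :: y :: s =>
      if last y s == linv x then cyclic_reduction_rec n' (belast y s) else w
  | _, _ => w
  end.

Definition cyclic_reduction k (w : seq (letter k)) : seq (letter k) :=
  cyclic_reduction_rec (size w) w.

Definition cyclic_length (F : groupType) k (A : 'I_k -> F) (g : F) : nat :=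
  size (cyclic_reduction (reduced_form A g)).

(* The semi-infinite reduced words; the rank is written k.+1 because
   measurable types are required to be inhabited. *)
Record boundary (k : nat) := Boundary {
  boundary_letter :> nat -> letter k.+1 ;
  boundary_reduced : forall n, boundary_letter n.+1 != linv (boundary_letter n)
}.

Definition initial_segment k (z : boundary k) (n : nat) : seq (letter k.+1) :=
  mkseq z n.

Lemma const_letter_reduced k (x : letter k) : x != linv x.
Proof. by case: x => i b; rewrite xpair_eqE eqxx; case: b. Qed.

HB.instance Definition _ k := gen_eqMixin (boundary k).
HB.instance Definition _ k := gen_choiceMixin (boundary k).
HB.instance Definition _ k := isPointed.Build (boundary k)
  (@Boundary k (fun=> (ord0, false)) (fun=> const_letter_reduced _)).

Definition cylinder k (v : seq (letter k.+1)) : set (boundary k) :=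
  [set z | initial_segment z (size v) = v].

(* The cylinders form a countable base of the topology of the boundary, so the
   sigma-algebra that they generate is the Borel one. *)
Definition cylinders k : set (set (boundary k)) := range (@cylinder k).

Definition borel_boundary (k : nat) := g_sigma_algebraType (@cylinders k).

HB.instance Definition _ k := Measurable.on (borel_boundary k).

Definition is_uniform (R : realType) k
    (m : probability (borel_boundary k) R) : Prop :=
  forall v : seq (letter k.+1), v != [::] -> reduced v ->
    m (cylinder v) =
      (((2 * k.+1%:R) * (2 * k.+1%:R - 1) ^+ (size v).-1)^-1)%:E.

Lemma image_probability d d' (T : measurableType d) (T' : measurableType d')
    (R : realType) (P : probability T R) (f : T -> T') :
  measurable_fun setT f ->
  exists m : probability T' R, forall B, m B = P (f @^-1` B).
Proof. by move=> mf; exists (distribution P (mfun_Sub (mem_set mf))). Qed.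

Section uniform_measure_exists.
Variables (R : realType) (k : nat).
Notation L := (letter k.+1).
Let point : L := (ord0, false).

Lemma linvK : involutive (@linv k.+1).
Proof. by case=> i b; rewrite /linv /= negbK. Qed.

(* The letters that may follow a (any letter at the start, when a is None).
   Expanding x in [0, 1[ in the corresponding mixed base sends Lebesgue measure
   to the uniform measure. *)
Let nexts (a : option L) : seq L :=
  [seq b <- enum {: L} | if a is Some c then b != linv c else true].

Let nlet (a : option L) (x : R) : L :=
  nth (odflt point a) (nexts a) (Num.truncn ((size (nexts a))%:R * x)).

Let step (s : option L * R) : option L * R :=
  (Some (nlet s.1 s.2),
   (size (nexts s.1))%:R * s.2
     - (Num.truncn ((size (nexts s.1))%:R * s.2))%:R).

Let digit (s : option L * R) (n : nat) : L :=
  let s' := iter n step s in nlet s'.1 s'.2.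

Let nlet_red c x : nlet (Some c) x != linv c.
Proof.
rewrite /nlet; set j := Num.truncn _.
case: (ltnP j (size (nexts (Some c)))) => hj.
  by have := mem_nth (odflt point (Some c)) hj; rewrite mem_filter => /andP[].
by rewrite nth_default //=; exact: const_letter_reduced.
Qed.

Let digit_red s n : digit s n.+1 != linv (digit s n).
Proof. by rewrite /digit iterS /=; exact: nlet_red. Qed.

Let clamp (x : R) : R := if (0 <= x) && (x < 1) then x else 0.

Let word_of (x : R) : borel_boundary k :=
  Boundary (digit_red (None, clamp x)).

Let wd (a : option L) (v : seq L) : R :=
  foldr (fun q r : R => q^-1 * r) 1
    (pairmap (fun a b => (size (nexts a))%:R) a (map Some v)).

Let digitS s n : digit s n.+1 = digit (step s) n.
Proof. by rewrite /digit iterSr. Qed.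

Let start_ok (a : option L) v := if v is b :: _ then b \in nexts a else true.

Let digit_itv v a : reduced v -> start_ok a v ->
  exists2 c : R, 0 <= c /\ c + wd a v <= 1 &
  0 < wd a v /\
  forall x, 0 <= x < 1 ->
   (mkseq (digit (a, x)) (size v) == v) = (c <= x < c + wd a v).
Proof.
elim: v a => [|b v IH] a rv /= sv.
  exists 0; first by rewrite /wd /= add0r.
  split; first by rewrite /wd /=.
  by move=> x hx; rewrite /wd /= add0r hx.
have [||c [c0 c1] [w0 hc]] := IH (Some b).
- by case: (v) rv => //= d v' /andP[].
- by case: (v) rv => //= d v' /andP[h _]; rewrite mem_filter mem_enum inE h.
set q := size (nexts a); set j := index b (nexts a).
have jq : (j < q)%N by rewrite /j /q index_mem.
have q0 : 0 < q%:R :> R by rewrite ltr0n (leq_ltn_trans _ jq).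
have wE : wd a (b :: v) = q%:R^-1 * wd (Some b) v by [].
have qV0 : 0 < (q%:R : R)^-1 by rewrite invr_gt0.
exists ((j%:R + c) / q%:R).
  split; first by rewrite mulr_ge0 ?addr_ge0 // ltW.
  rewrite wE (mulrC _ (wd _ _)) -mulrDl ler_pdivrMr // mul1r -addrA.
  apply: (@le_trans _ _ (j%:R + 1)); first by rewrite lerD2l.
  by rewrite natr1 ler_nat.
split; first by rewrite wE mulr_gt0.
move=> x /andP[x0 x1].
have qx0 : 0 <= q%:R * x by rewrite mulr_ge0 // ltW.
rewrite wE (mulrC _ (wd _ _)) -mulrDl ler_pdivrMr // ltr_pdivlMr // (mulrC x).
set t := Num.truncn (q%:R * x).
have /andP[t1 t2] : t%:R <= q%:R * x < t.+1%:R.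
  exact: Num.Theory.truncn_itv.
have tq : (t < q)%N.
  rewrite -(ltr_nat R); apply: le_lt_trans t1 _.
  by rewrite -[ltRHS]mulr1 ltr_pM2l.
have -> : mkseq (digit (a, x)) (size v).+1 =
  nth point (nexts a) t :: mkseq (digit (Some (nth point (nexts a) t), q%:R * x - t%:R)) (size v).
  rewrite /mkseq /= -[1%N]/(1 + 0)%N iotaDl -map_comp; congr (_ :: _).
    by rewrite /digit /= /nlet -/q -/t (set_nth_default point).
  apply: eq_map => i /=; rewrite add1n digitS /step /= -/q -/t.
  by congr (digit (Some _, _) _); rewrite /nlet -/q -/t (set_nth_default point).
rewrite eqseq_cons.
have hb : nth point (nexts a) t == b = (t == j).
  apply/eqP/eqP => [tb|->]; last by rewrite nth_index // -index_mem.
  by rewrite /j -tb index_uniq // filter_uniq // enum_uniq.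
rewrite hb; case: eqP => [tj|tj] /=; last first.
  apply/esym/negP => /andP[h1 h2]; apply: tj; apply/eqP.
  have : (j%:R < t.+1%:R :> R) by lra.
  have : (t%:R < j.+1%:R :> R) by rewrite -natr1; lra.
  by rewrite !ltr_nat !ltnS eqn_leq => -> ->.
rewrite tj in t1 t2 *.
have -> : nth point (nexts a) j = b by rewrite nth_index // -index_mem.
rewrite hc; last first.
  by rewrite -natr1 in t2; apply/andP; split; lra.
by rewrite lerBrDl ltrBlDl addrA.
Qed.

Let clamp_itv x : 0 <= clamp x < 1.
Proof. by rewrite /clamp; case: ifP => // _; rewrite lexx ltr01. Qed.

Let measurable_clamp : measurable_fun setT clamp.
Proof.
apply: measurable_fun_ifT => //.
by apply: measurable_and; [exact: measurable_fun_ler|exact: measurable_fun_ltr].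
Qed.

Lemma initial_segment_reduced (z : boundary k) n : reduced (initial_segment z n).
Proof.
rewrite /reduced /initial_segment; case: n => //= n.
rewrite -[1%N]/(0.+1) ; elim: n 0%N => //= n IH m.
by rewrite boundary_reduced IH.
Qed.

Lemma cylinder_nil : cylinder [::] = [set: boundary k].
Proof. by apply/seteqP; split. Qed.

Lemma cylinder_not_reduced (v : seq L) : ~~ reduced v -> cylinder v = set0.
Proof.
move=> rv; apply/seteqP; split => // z /= zv.
by move: rv; rewrite -zv initial_segment_reduced.
Qed.

Let preimage_cylinder (v : seq L) : reduced v ->
  exists2 c : R, 0 <= c /\ c + wd None v <= 1 &
  0 < wd None v /\ word_of @^-1` cylinder v = clamp @^-1` [set` `[c, c + wd None v[%R].
Proof.
move=> rv; have [||c c01 [w0 hc]] := @digit_itv v None => //.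
  by case: (v) => //= b s; rewrite mem_filter mem_enum.
exists c => //; split=> //; rewrite /cylinder; apply/seteqP; split => x /=.
  by move=> xv; rewrite in_itv /= -hc //; apply/eqP.
by rewrite in_itv /= -hc // => /eqP.
Qed.

Let measurable_word_of : measurable_fun [set: R] word_of.
Proof.
apply: (@measurability _ _ R (borel_boundary k) setT word_of (@cylinders k)) => //.
move=> _ [_ [v _ <-] <-]; rewrite setTI.
have [rv|rv] := boolP (reduced v); last first.
  by rewrite cylinder_not_reduced // preimage_set0.
have [c _ [_ ->]] := preimage_cylinder rv.
by rewrite -[X in measurable X]setTI; exact: measurable_clamp.
Qed.

Let size_nexts (a : option L) :
  size (nexts a) = if a is Some _ then (2 * k.+1).-1 else (2 * k.+1)%N.
Proof.
have cL : size (enum {: L}) = (2 * k.+1)%N.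
  by rewrite -cardE card_prod card_ord card_bool mulnC.
case: a => [c|]; rewrite /nexts; last by rewrite filter_predT.
rewrite -cL -(count_predC (pred1 (linv c)) (enum {: L})).
by rewrite count_uniq_mem ?enum_uniq // mem_enum /= size_filter.
Qed.

Let wdE (v : seq L) : v != [::] ->
  wd None v = ((2 * k.+1%:R) * (2 * k.+1%:R - 1) ^+ (size v).-1)^-1.
Proof.
have qE : ((2 * k.+1).-1)%:R = 2 * k.+1%:R - 1 :> R.
  by rewrite -subn1 natrB // natrM.
case: v => // b v _; rewrite /wd /= size_nexts natrM [RHS]invfM; congr (_ * _).
elim: v b => [|c v IH] b /=; first by rewrite expr0 invr1.
by rewrite size_nexts IH qE exprS [RHS]invfM.
Qed.

Lemma is_uniform_exists : exists m : probability (borel_boundary k) R, is_uniform m.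
Proof.
have [m mE] := @image_probability _ _ _ _ R (uniform_prob (@ltr01 R))
  word_of measurable_word_of.
exists m => v v0 rv; rewrite mE.
have [c [c0 c1] [w0 cE]] := preimage_cylinder rv.
rewrite -wdE // cE.
change ((\int[lebesgue_measure]_(x in clamp @^-1` [set` `[c, c + wd None v[%R])
  (uniform_pdf 0 1 x)%:E)%E = (wd None v)%:E).
rewrite integral_uniform_pdf.
set I := `[c, _[%classic; set D := _ `&` _.
have mD : measurable D.
  have := measurable_clamp measurableT (measurable_itv `[c, c + wd None v[%R).
  by rewrite setTI => mc; apply: measurableI => //; exact: mc.
rewrite (eq_integral (cst 1%E)); last first.
  move=> x; rewrite inE => -[_] /=; rewrite in_itv /= /uniform_pdf => ->.
  by rewrite subr0 invr1.
rewrite integral_cst // mul1e -(@measureU0 _ _ _ lebesgue_measure D [set 1]) //; last 1 first.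
  exact: lebesgue_measure_set1.
have -> : D `|` [set 1] = I `|` [set 1].
  apply/seteqP; split => x [] /=; rewrite ?in_itv /=; [| by right| |by right].
    move=> [] /[swap] /=; rewrite in_itv /= => /andP[x0 x1].
    rewrite /I /= !in_itv /= /clamp x0 /=.
    by case: ltP => x1' //= h; [left|right; apply/eqP; rewrite eq_le x1 x1'].
  move=> /andP[cx xc]; left; rewrite /D /I /= !in_itv /= /clamp.
  have x0 : 0 <= x := le_trans c0 cx.
  have x1 : x < 1 := lt_le_trans xc c1.
  by split; apply/andP; rewrite ?x0 ?x1 /= ?cx ?xc ?(ltW x1).
have mI : measurable I by exact: measurable_itv.
rewrite measureU0 //; last exact: lebesgue_measure_set1.
have e : lebesgue_measure I = (wd None v)%:E.
  by rewrite /I lebesgue_measure_itv /= lte_fin ltrDl w0 -EFinD addrC addKr.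
all: by [exact: mI|exact: e].
Qed.

End uniform_measure_exists.

Lemma take_initial_segment k (z : boundary k) n m :
  (n <= m)%N -> take n (initial_segment z m) = initial_segment z n.
Proof. by move=> nm; rewrite /initial_segment -map_take take_iota (minn_idPl nm). Qed.

Lemma setI_closed_cylinders k : setI_closed (@cylinders k).
Proof.
have H (v w : seq (letter k.+1)) : (size v <= size w)%N ->
    cylinders (cylinder v `&` cylinder w).
  move=> vw; have [e|ne] := eqVneq (take (size v) w) v.
    exists w => //; apply/seteqP; split => [z /= zw|z []//]; split => //.
    by rewrite /cylinder /= -(take_initial_segment z vw) zw.
  exists [:: (ord0, false); linv (ord0, false)] => //.
  rewrite cylinder_not_reduced //.
  apply/esym/seteqP; split => // z [/= zv zw]; move/eqP: ne; apply.
  by rewrite -[in LHS]zw take_initial_segment.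
move=> _ _ [v _ <-] [w _ <-]; have [/H //|/ltnW/H] := leqP (size v) (size w).
by rewrite setIC.
Qed.

Lemma is_uniform_unique (R : realType) k
    (m1 m2 : probability (borel_boundary k) R) :
  is_uniform m1 -> is_uniform m2 ->
  forall B : set (borel_boundary k), measurable B -> m1 B = m2 B.
Proof.
move=> u1 u2 B mB.
apply: (@measure_unique _ R (borel_boundary k) (@cylinders k) (fun=> setT)) => //.
- exact: setI_closed_cylinders.
- by move=> _; exists [::] => //; exact: cylinder_nil.
- by rewrite bigcup_const.
- move=> _ [v _ <-]; have [->|v0] := eqVneq v [::].
    rewrite cylinder_nil; transitivity (1%:E : \bar R); [|symmetry]; exact: probability_setT.
  have [rv|rv] := boolP (reduced v); first exact: etrans (u1 v v0 rv) (esym (u2 v v0 rv)).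
  by rewrite cylinder_not_reduced // !measure0.
- by move=> _; exact: le_lt_trans (probability_le1 m1 measurableT) (ltry 1).
Qed.

Definition uniform_measure (R : realType) k : probability (borel_boundary k) R :=
  sval (cid (is_uniform_exists R k)).

Lemma uniform_measureP (R : realType) k : is_uniform (uniform_measure R k).
Proof. exact: svalP. Qed.

Definition is_generic_stretching_factor (R : realType) (F : groupType) k
    (A : 'I_k.+1 -> F) (f : F -> F) (l : R) : Prop :=
  {ae uniform_measure R k, forall z : borel_boundary k,
    (cyclic_length A (f (word_val A (initial_segment z n))))%:R / n%:R @[n --> \oo] --> l}.

Lemma is_generic_stretching_factor_unique (R : realType) (F : groupType) k
    (A : 'I_k.+1 -> F) (f : F -> F) (l1 l2 : R) :
  is_generic_stretching_factor A f l1 -> is_generic_stretching_factor A f l2 -> l1 = l2.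
Proof.
move=> h1 h2; apply: contrapT => ne.
have : {ae uniform_measure R k, forall z : borel_boundary k, False}.
  apply: filterS2 h1 h2 => z c1 c2; apply: ne.
  exact: (cvg_unique _ c1 c2).
move=> [N [mN N0 sN]]; have : uniform_measure R k setT = 0%E.
  by apply/eqP; rewrite -measure_le0 -N0 le_measure ?inE // => z _; apply: sN.
by rewrite probability_setT => -[] /eqP; rewrite oner_eq0.
Qed.

(* Main.v *)
(** The automorphism is phi : a -> ababa, b -> ba, with inverse
    a -> a b^-2, b -> b^3 a^-1, where a and b are two basis elements and the
    others are fixed. Reading a random reduced word letter by letter, the
    increment of the length of the reduced image is governed by a finite
    Markov chain that remembers the last letter read and how much of the end
    of the image can still be cancelled. Solving the Poisson equation of this
    chain yields a bounded correction which turns the length of the image,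
    minus l times the length of the word, into a martingale with bounded
    increments. Its fourth moment is O(n^2), so by Borel-Cantelli it is o(n)
    almost surely. Passing to the cyclically reduced length costs only O(1) by
    bounded cancellation, plus the overlap between the word and its inverse,
    whose tail is exponentially small. With q = 2k - 1 the two growth rates
    differ by 4 (3 q^3 - 8 q^2 - 1) / (q^4 (q + 1)), which is not zero for
    q >= 3. *)
Require Import Defs.
From mathcomp Require Import all_boot all_order all_algebra.
From mathcomp Require Import all_classical all_reals all_analysis.
From mathcomp Require Import ring lra zify.

Set Implicit Arguments.
Unset Strict Implicit.
Unset Printing Implicit Defensive.

Import Order.TTheory GRing.Theory Num.Theory.
Import numFieldNormedType.Exports.

Local Open Scope ring_scope.

(** * Free reduction on a stack, word length and cyclically reduced length *)

Section FreeReduction.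
Variables (k : nat) (F : groupType) (A : 'I_k.+1 -> F).
Hypothesis hA : free_basis A.
Notation L := (letter k.+1).
Notation val := (word_val A).
Implicit Types (x y : L) (s u v w : seq L) (g h : F).

Lemma linv_eq_sym x y : (x == linv y) = (y == linv x).
Proof. by rewrite -[x in LHS]linvK (can_eq (@linvK k)) eq_sym. Qed.

Lemma reduced_rev w : reduced (rev w) = reduced w.
Proof.
rewrite /reduced rev_sorted; apply: eq_sorted => x y.
by rewrite linv_eq_sym.
Qed.

Lemma reduced_cat u v : reduced (u ++ v) -> reduced u /\ reduced v.
Proof. by rewrite /reduced => /cat_sorted2[-> ->]. Qed.

Lemma reduced_rcons_cat u x y v :
  reduced (rcons u x ++ y :: v) =
  [&& reduced (rcons u x), y != linv x & reduced (y :: v)].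
Proof. by case: u => //= z u; rewrite /reduced /= cat_path last_rcons /=. Qed.

(* The argument s is a reduced word written backwards, so that multiplying by a
   letter on the right acts on the head of s. *)
Definition push s x :=
  if s is y :: s' then if x == linv y then s' else x :: s else [:: x].

Lemma push_reduced s x : reduced s -> reduced (push s x).
Proof.
case: s => //= y s ys; case: ifPn => [_|xy]; first exact: path_sorted ys.
by rewrite /reduced /= linv_eq_sym xy.
Qed.

Lemma foldl_push_reduced s w : reduced s -> reduced (foldl push s w).
Proof. by elim: w s => //= x w IH s rs; apply: IH; exact: push_reduced. Qed.

Lemma word_val_nil : val [::] = 1%g.
Proof. by rewrite /word_val big_nil. Qed.

Lemma word_val_cons x w : val (x :: w) = (letter_val A x * val w)%g.
Proof. by rewrite /word_val big_cons. Qed.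

Lemma word_val_rcons w x : val (rcons w x) = (val w * letter_val A x)%g.
Proof. by rewrite -cats1 word_val_cat /word_val big_seq1. Qed.

Lemma val_rev_push s x :
  val (rev (push s x)) = (val (rev s) * letter_val A x)%g.
Proof.
case: s => [|y s] /=; first by rewrite /word_val big_seq1 big_nil mul1g.
case: eqP => [->|_]; last by rewrite rev_cons word_val_rcons.
by rewrite rev_cons word_val_rcons letter_valV mulgK.
Qed.

Lemma val_rev_foldl_push s w :
  val (rev (foldl push s w)) = (val (rev s) * val w)%g.
Proof.
elim: w s => [|x w IH] s /=; first by rewrite {3}/word_val big_nil mulg1.
by rewrite IH val_rev_push word_val_cons mulgA.
Qed.

Definition len g := size (reduced_form A g).

Lemma len_word w : reduced w -> len (val w) = size w.
Proof. by move=> rw; rewrite /len reduced_form_eq. Qed.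

(** Pushing the letters of [w] one by one onto the backwards word [s] computes the reduced form of
    the product. *)
Lemma len_rev s w : reduced s ->
  len (val (rev s) * val w) = size (foldl push s w).
Proof.
move=> rs; rewrite -val_rev_foldl_push len_word ?size_rev //.
by rewrite reduced_rev foldl_push_reduced.
Qed.

Lemma size_foldl_push s w : (size (foldl push s w) <= size s + size w)%N.
Proof.
elim: w s => [|x w IH] s /=; first by rewrite addn0.
rewrite (leq_trans (IH _)) // addnS -addSn leq_add2r.
by case: s => //= y s; case: ifP => //= _; rewrite -addn2 leq_addr.
Qed.

Lemma word_of g : exists2 w, reduced w & val w = g /\ size w = len g.
Proof. by have [r e] := reduced_formP g hA; exists (reduced_form A g). Qed.

Lemma lenM g h : (len (g * h) <= len g + len h)%N.
Proof.
have [u ru [<- <-]] := word_of g; have [v rv [<- <-]] := word_of h.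
by rewrite -{1}[u]revK len_rev ?reduced_rev // -(size_rev u) size_foldl_push.
Qed.

Lemma len1 : len 1 = 0%N.
Proof. by rewrite -word_val_nil len_word. Qed.

Definition winv w := rev (map (@linv k.+1) w).

Lemma winvK : involutive winv.
Proof. by move=> w; rewrite /winv map_rev revK (mapK (@linvK k)). Qed.

Lemma val_winv w : val (winv w) = ((val w)^-1)%g.
Proof.
elim: w => [|x w IH]; first by rewrite /winv /= /word_val big_nil invg1.
by rewrite /winv /= rev_cons word_val_rcons IH word_val_cons letter_valV invgM.
Qed.

Lemma size_winv w : size (winv w) = size w.
Proof. by rewrite /winv size_rev size_map. Qed.

Lemma reduced_winv w : reduced (winv w) = reduced w.
Proof.
rewrite /winv reduced_rev /reduced sorted_map; apply: eq_sorted => x y /=.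
by rewrite (can_eq (@linvK k)).
Qed.

Lemma lenV g : len g^-1 = len g.
Proof.
have [u ru [<- <-]] := word_of g.
by rewrite -val_winv len_word ?size_winv // reduced_winv.
Qed.

Lemma len_val_le w : (len (val w) <= size w)%N.
Proof.
rewrite -[val w]mul1g -word_val_nil -[[::]]/(rev [::]) len_rev //.
exact: size_foldl_push.
Qed.

Lemma cyclic_reductionP w : exists t, w = t ++ cyclic_reduction w ++ winv t.
Proof.
rewrite /cyclic_reduction; move: (size w) => n; elim: n w => [|n IH] w.
  by exists [::]; rewrite /= cats0.
case: w => [|x [|y s]]; [by exists [::]|by exists [::]|].
rewrite /=; have [e|_] := eqVneq (last y s) (linv x); last first.
  by exists [::]; rewrite cats0.
have [t et] := IH (belast y s); exists (x :: t) => /=; congr (_ :: _).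
by rewrite [LHS]lastI e {1}et /winv /= rev_cons -!rcons_cat.
Qed.

Lemma cyclic_length_le g : (cyclic_length A g <= len g)%N.
Proof.
rewrite /cyclic_length /len.
have [t {2}->] := cyclic_reductionP (reduced_form A g).
by rewrite !size_cat; lia.
Qed.

(** If [g = t c t^-1] with [c] the cyclic reduction, then [g^2 = t c c t^-1]. This bounds the cyclic
    length from below by ordinary lengths, to which bounded cancellation applies. *)
Lemma len_sqr_le g : (len (g * g) <= len g + cyclic_length A g)%N.
Proof.
have [w rw [<- <-]] := word_of g.
rewrite /cyclic_length reduced_form_eq //.
have [t et] := cyclic_reductionP w; set c := cyclic_reduction w in et *.
have -> : (val w * val w)%g = val (t ++ c ++ c ++ winv t).
  by rewrite et !word_val_cat !val_winv -!mulgA mulKg.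
rewrite (leq_trans (len_val_le _)) //.
by have := congr1 size et; rewrite !size_cat; lia.
Qed.

End FreeReduction.
Arguments push {k} s x.

(** * Lipschitz homomorphisms and bounded cancellation *)

Section Homomorphism.
Variables (k : nat) (F : groupType) (A : 'I_k.+1 -> F).
Hypothesis hA : free_basis A.
Notation L := (letter k.+1).
Notation val := (word_val A).
Notation len := (len A).
Implicit Types (x y : L) (s u v w p q : seq L) (g h : F).

Lemma hom1 (f : {multiplicative F -> F}) : f 1%g = 1%g.
Proof. by apply: (mulgI (f 1%g)); rewrite -gmulfM !mulg1. Qed.

Lemma homV (f : {multiplicative F -> F}) g : f (g^-1)%g = ((f g)^-1)%g.
Proof. by apply: (mulgI (f g)); rewrite -gmulfM !mulgV hom1. Qed.

Lemma hom_lipschitz (f : {multiplicative F -> F}) :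
  exists K : nat, forall g, (len (f g) <= K * len g)%N.
Proof.
exists (\max_(x : L) len (f (letter_val A x)))%N => g.
have [w rw [<- <-]] := word_of hA g.
elim: w {rw} => [|x w IH] /=; first by rewrite word_val_nil hom1 len1.
rewrite word_val_cons gmulfM (leq_trans (lenM hA _ _)) // mulnS leq_add //.
by rewrite (leq_bigmax x).
Qed.

Lemma common_prefix u v : reduced u -> reduced v ->
  exists p u' v', [/\ u = p ++ u', v = p ++ v' & reduced (winv u' ++ v')].
Proof.
elim: u v => [|x u IH] v ru rv; first by exists [::], [::], v.
case: v rv => [|y v] rv.
  by exists [::], (x :: u), [::]; split; rewrite // cats0 reduced_winv.
have [exy|xy] := eqVneq x y.
  rewrite -exy in rv *.
  have [p [u' [v' [-> -> r]]]] := IH v (path_sorted ru) (path_sorted rv).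
  by exists (x :: p), u', v'.
exists [::], (x :: u), (y :: v); split => //.
move: ru; rewrite -reduced_winv /winv /= rev_cons reduced_rcons_cat => ->.
by rewrite linvK eq_sym xy.
Qed.

Lemma push_suffix s x t q : push s x = t ++ q ->
  (exists t', s = t' ++ q) \/ q = push s x.
Proof.
case: t => [|y t]; first by right.
case: s => [[] _|z s /=]; first by case: t => //= <-; left; exists [::].
case: ifP => _ e; left; first by exists (z :: y :: t); rewrite e.
by exists t; case: e.
Qed.

(** A stack changes only at its head, so a bottom part of the final stack either was there from the
    start or was the whole stack at some moment. *)
Lemma foldl_push_suffix s w t q : foldl push s w = t ++ q ->
  (exists t', s = t' ++ q) \/ exists w1 w2, w = w1 ++ w2 /\ q = foldl push s w1.
Proof.
elim: w s => [|x w IH] s /=; first by move=> ->; left; exists t.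
move=> /IH[[t' /push_suffix[|->]]|[w1 [w2 [-> ->]]]]; first by left.
  by right; exists [:: x], w.
by right; exists (x :: w1), w2.
Qed.

Variables (f : {multiplicative F -> F}) (img : L -> seq L).
Hypothesis fimg : forall x, f (letter_val A x) = val (img x).

(** The reduced form of the image of [w], written backwards and updated one letter of [w] at a
    time. *)
Definition stack w := foldl (fun s x => foldl push s (img x)) [::] w.

Lemma stack_rcons w x : stack (rcons w x) = foldl push (stack w) (img x).
Proof. by rewrite /stack foldl_rcons. Qed.

Lemma stack_reduced w : reduced (stack w).
Proof.
elim/last_ind: w => // w x IH.
by rewrite stack_rcons foldl_push_reduced.
Qed.

Lemma val_stack w : val (rev (stack w)) = f (val w).
Proof.
elim/last_ind: w => [|w x IH]; first by rewrite word_val_nil hom1.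
by rewrite stack_rcons val_rev_foldl_push IH word_val_rcons gmulfM fimg.
Qed.

Lemma len_stack w : len (f (val w)) = size (stack w).
Proof.
by rewrite -val_stack len_word ?size_rev // reduced_rev stack_reduced.
Qed.

(* The path of the images of the prefixes of w passes near every vertex of the
   geodesic from 1 to f(w), because the geodesic is what is left of that path
   after cancellation. *)
Lemma prefix_near (K : nat) w p t : (forall x, (size (img x) <= K)%N) ->
  rev (stack w) = p ++ t ->
  exists w1 w2 e, [/\ w = w1 ++ w2, val p = (f (val w1) * val e)%g &
    (size e <= K)%N].
Proof.
move=> hK /(canRL revK); rewrite rev_cat -{2}[p]revK.
elim/last_ind: w (rev t) => [|w x IH] {}t.
  move=> /esym/eqP; rewrite -size_eq0 size_cat addn_eq0 => /andP[_].
  rewrite size_eq0 => /eqP->; exists [::], [::], [::].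
  by rewrite word_val_nil hom1 mulg1.
rewrite stack_rcons => /foldl_push_suffix[[t' /IH]|].
  move=> [w1 [w2 [e [-> -> se]]]]; exists w1, (rcons w2 x), e.
  by rewrite rcons_cat.
move=> [e [e' [xe ->]]]; exists w, [:: x], e; split; first by rewrite cats1.
  by rewrite val_rev_foldl_push val_stack.
by rewrite (leq_trans _ (hK x)) // xe size_cat leq_addr.
Qed.

(** What cancels is the common prefix [p] of the reduced forms of [f(u^-1)] and [f(v)]. By
    [prefix_near], the end of [p] is close to the images of a prefix [s1] of [u^-1] and of a prefix
    [t1] of [v]. Since [f'] is Lipschitz, [s1^-1 t1] is short; as it is reduced, [t1] is short, and
    hence so is [p]. *)
Lemma bounded_cancellation (f' : {multiplicative F -> F}) : cancel f f' ->
  exists C : nat, forall u v, reduced (u ++ v) ->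
  (len (f (val u)) + len (f (val v)) <= len (f (val u * val v)%g) + C)%N.
Proof.
move=> fK; have [K' hK'] := hom_lipschitz f'; have [K0 hK0] := hom_lipschitz f.
pose K := (\max_(x : L) size (img x))%N.
have hK x : (size (img x) <= K)%N by rewrite /K (leq_bigmax x).
(* The factor 2 multiplies the bound on [size p]: [p] is lost once from each of the two images. *)
exists (2 * (K0 * (K' * (K + K)) + K))%N => u v ruv.
have rS w : reduced (rev (stack w)) by rewrite reduced_rev stack_reduced.
have [p [g [h [eu ev rgh]]]] := common_prefix (rS (winv u)) (rS v).
have [s1 [s2 [e1 [es pe1 se1]]]] := prefix_near hK eu.
have [t1 [t2 [e2 [et pe2 se2]]]] := prefix_near hK ev.
have fu : f (val u) = (val (p ++ g))^-1%g.
  by rewrite -eu val_stack val_winv homV invgK.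
have fv : f (val v) = val (p ++ h) by rewrite -ev val_stack.
have -> : len (f (val u)) = (size p + size g)%N.
  by rewrite fu lenV // len_word ?size_cat // -eu.
have -> : len (f (val v)) = (size p + size h)%N.
  by rewrite fv len_word ?size_cat // -ev.
have -> : len (f (val u * val v)%g) = (size g + size h)%N.
  rewrite gmulfM fu fv !word_val_cat invgM -mulgA mulKg -val_winv -word_val_cat.
  by rewrite len_word // size_cat size_winv.
suff : (size p <= K0 * (K' * (K + K)) + K)%N by lia.
have -> : size p = len (val p).
  by rewrite len_word //; move: (rS v); rewrite ev => /reduced_cat[].
rewrite pe2 (leq_trans (lenM hA _ _)) // leq_add //; last first.
  by rewrite (leq_trans (len_val_le hA _)).
rewrite (leq_trans (hK0 _)) // leq_mul2l (leq_trans (len_val_le hA _)) ?orbT //.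
(* This word is a factor of the reduced word [u ++ v], around the junction. *)
have rst : reduced (winv s1 ++ t1).
  have : reduced (winv s2 ++ (winv s1 ++ t1) ++ t2).
    rewrite -catA -et catA (_ : winv s2 ++ winv s1 = u) //.
    by rewrite -[RHS]winvK es /winv map_cat rev_cat.
  by move=> /reduced_cat[_ /reduced_cat[]].
(* Equate the two expressions [f(s1) e1] and [f(t1) e2] of [val p], then apply [f']. *)
have est : val (winv s1 ++ t1) = f' (val e1 * (val e2)^-1)%g.
  rewrite -[LHS]fK word_val_cat val_winv gmulfM homV; congr (f' _).
  by apply: (mulIg (val e2)); rewrite -mulgA -pe2 pe1 mulKg mulgVK.
apply: (@leq_trans (len (val (winv s1 ++ t1)))).
  by rewrite len_word // size_cat leq_addl.
rewrite est (leq_trans (hK' _)) // leq_mul2l (leq_trans (lenM hA _ _)) ?orbT //.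
by rewrite lenV // leq_add // (leq_trans (len_val_le hA _)).
Qed.

End Homomorphism.

(** * Cancellation of a reduced word with a copy of itself *)

Section Overlap.
Variables (k : nat).
Notation L := (letter k.+1).
Implicit Types (u v w : seq L).

Let x0 : L := (ord0, false).

Definition mirrored w i :=
  nth x0 w ((size w).-1 - i) == linv (nth x0 w i).

(* The number of letters of w that cancel with a second copy of w in w * w. *)
Definition overlap w := find (fun i => ~~ mirrored w i) (iota 0 (size w)).

(** The middle of [w] breaks the symmetry: in odd length the middle letter would be its own inverse,
    in even length the two middle letters would cancel. *)
Lemma not_all_mirrored w : reduced w -> w != [::] ->
  exists2 i, (2 * i < size w)%N & ~~ mirrored w i.
Proof.
move=> rw w0; have {w0} n0 : (0 < size w)%N by case: (w) w0.
rewrite /mirrored.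
have := odd_double_half (size w); set m := (size w)./2.
rewrite -muln2; clearbody m; case: odd => /= e.
  exists m; first by lia.
  have -> : ((size w).-1 - m = m)%N by lia.
  exact: const_letter_reduced.
exists m.-1; first by lia.
have -> : ((size w).-1 - m.-1 = m.-1.+1)%N by lia.
by move/(sortedP x0): rw; apply; lia.
Qed.

Lemma overlap_mirrored w i : (i < overlap w)%N -> mirrored w i.
Proof.
move=> io; have := before_find 0%N io; rewrite nth_iota => [/negbFE //|].
by rewrite (leq_trans io) // -[leqRHS](size_iota 0) find_size.
Qed.

Lemma overlap_lt w : reduced w -> w != [::] -> (2 * overlap w < size w)%N.
Proof.
move=> rw /(not_all_mirrored rw)[i iw]; apply: contraNltn => ow.
by apply: overlap_mirrored; lia.
Qed.

Lemma not_mirrored_overlap w : reduced w -> w != [::] ->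
  ~~ mirrored w (overlap w).
Proof.
move=> rw w0; have [i iw mi] := not_all_mirrored rw w0.
have /(nth_find 0%N) : has (fun i => ~~ mirrored w i) (iota 0 (size w)).
  by apply/hasP; exists i => //; rewrite mem_iota; lia.
by rewrite nth_iota //; have := overlap_lt rw w0; rewrite /overlap; lia.
Qed.

(** The letters that meet are those at the first index that is not mirrored, so cancellation in the
    square of [w] stops exactly there. *)
Lemma reduced_overlap w : reduced w -> w != [::] ->
  reduced (take (size w - overlap w) w ++ drop (overlap w) w).
Proof.
move=> rw w0; have := overlap_lt rw w0; have := not_mirrored_overlap rw w0.
rewrite /mirrored; move: (overlap w) => j mj jw.
have -> : (size w - j = ((size w).-1 - j).+1)%N by lia.
rewrite (take_nth x0); last by lia.
rewrite (drop_nth x0); last by lia.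
rewrite reduced_rcons_cat -(take_nth x0); last by lia.
rewrite -(drop_nth x0); last by lia.
apply/and3P; split; [exact: take_sorted| |exact: drop_sorted].
by rewrite linv_eq_sym.
Qed.

Lemma val_overlap (F : groupType) (A : 'I_k.+1 -> F) w :
  reduced w -> w != [::] ->
  (word_val A w * word_val A w)%g =
  (word_val A (take (size w - overlap w) w) *
   word_val A (drop (overlap w) w))%g.
Proof.
move=> rw w0; have := overlap_lt rw w0; have := @overlap_mirrored w.
move: (overlap w) => j mj jw.
have e : drop (size w - j) w = winv (take j w).
  apply: (@eq_from_nth _ x0).
    by rewrite size_drop size_winv size_takel; lia.
  move=> i; rewrite size_drop => ij; rewrite nth_drop /winv nth_rev; last first.
    by rewrite size_map size_takel; lia.
  rewrite size_map size_takel; last by lia.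
  rewrite (nth_map x0); last by rewrite size_takel; lia.
  rewrite nth_take; last by lia.
  have /eqP <- : mirrored w (j - i.+1) by apply: mj; lia.
  by congr (nth _ _ _); lia.
have ea : word_val A w =
    (word_val A (take (size w - j) w) * (word_val A (take j w))^-1)%g.
  by rewrite -val_winv -e -word_val_cat cat_take_drop.
have eb : word_val A w = (word_val A (take j w) * word_val A (drop j w))%g.
  by rewrite -word_val_cat cat_take_drop.
by rewrite {1}ea eb -mulgA mulKg.
Qed.

End Overlap.

(** Write [w^2 = u v] without cancellation, where [u] and [v] are [w] shortened by [overlap w]
    letters. Then [f(u)] and [f(v)] are almost as long as [f(w)], and bounded cancellation makes
    [f(w)^2] almost twice as long as [f(w)]; [len_sqr_le] turns this into a lower bound for the
    cyclic length. *)
Lemma cyclic_length_near (k : nat) (F : groupType) (A : 'I_k.+1 -> F)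
    (f f' : {multiplicative F -> F}) : free_basis A -> cancel f f' ->
  exists C : nat, forall w, reduced w -> w != [::] ->
  (len A (f (word_val A w)) <=
   cyclic_length A (f (word_val A w)) + C * (overlap w).+1)%N.
Proof.
move=> hA fK.
have fimg x :
    f (letter_val A x) = word_val A (reduced_form A (f (letter_val A x))).
  by have [_ ->] := reduced_formP (f (letter_val A x)) hA.
have [C hC] := bounded_cancellation hA fimg fK.
have [K hK] := hom_lipschitz hA f.
exists (C + 2 * K)%N => w rw w0.
have rj := reduced_overlap rw w0; have jw := overlap_lt rw w0.
set j := overlap w in rj jw *; set g := word_val A w.
have := len_sqr_le hA (f g).
rewrite -gmulfM val_overlap // -/j; have := hC _ _ rj.
set u := word_val A (take _ _); set v := word_val A (drop _ _) => h1 h2.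
pose a := word_val A (drop (size w - j) w); pose b := word_val A (take j w).
have gu : g = (u * a)%g by rewrite -word_val_cat cat_take_drop.
have gv : g = (b * v)%g by rewrite -word_val_cat cat_take_drop.
have la : (len A (f a) <= K * j)%N.
  rewrite (leq_trans (hK _)) // leq_mul2l.
  rewrite (leq_trans (len_val_le hA _)) ?orbT //.
  by rewrite size_drop; lia.
have lb : (len A (f b) <= K * j)%N.
  rewrite (leq_trans (hK _)) // leq_mul2l.
  rewrite (leq_trans (len_val_le hA _)) ?orbT //.
  by rewrite size_takel; lia.
have := lenM hA (f u) (f a); rewrite -gmulfM -gu => h3.
have := lenM hA (f b) (f v); rewrite -gmulfM -gv => h4.
by rewrite mulnS mulnDl; lia.
Qed.

(** * Averages over reduced words and almost sure growth rates *)

Section Words.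
Variables (R : realType) (k : nat).
Notation L := (letter k.+1).
Notation q := (2 * k.+1%:R - 1 : R).
Notation m := (uniform_measure R k).
Implicit Types (x y : L) (w : seq L) (f g : seq L -> R).

Let x0 : L := (ord0, false).

Fixpoint words n : seq (seq L) :=
  if n is n'.+1 then
    [seq rcons w x | w <- words n',
                     x <- [seq x <- enum {: L} | reduced (rcons w x)]]
  else [:: [::]].

Lemma reduced_rcons w x : w != [::] ->
  reduced (rcons w x) = reduced w && (x != linv (last x0 w)).
Proof.
case: w => // y w _.
by rewrite /reduced /= rcons_path.
Qed.

Lemma mem_words n w : (w \in words n) = reduced w && (size w == n).
Proof.
elim: n w => [|n IH] w /=.
  by rewrite inE; case: w => //= x w; rewrite andbF.
apply/allpairsPdep/idP => [[u [x [un]]]|].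
  rewrite mem_filter => /andP[r _ ->]; rewrite r size_rcons eqSS.
  by move: un; rewrite IH => /andP[].
case/lastP: w => [|w x]; first by rewrite andbF.
rewrite size_rcons eqSS => /andP[r /eqP wn]; exists w, x.
rewrite mem_filter r mem_enum IH wn eqxx andbT; split=> //.
by move: r; rewrite -cats1 => /reduced_cat[].
Qed.

(* The normalising factor is the mass of a cylinder only for n > 0. *)
Definition expect n f : R :=
  ((2 * k.+1%:R) * q ^+ n.-1)^-1 * \sum_(w <- words n) f w.

Lemma q_gt0 : 0 < q.
Proof. by rewrite -natr1; have : 0 <= k%:R :> R by []; lra. Qed.

Lemma card_not_linv y : #|[pred x | x != linv y]|%:R = q :> R.
Proof.
have := cardC (pred1 (linv y)); rewrite card1 card_prod card_ord card_bool.
move=> /(congr1 (fun n : nat => n%:R : R)); rewrite natrD natrM.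
rewrite (_ : #|predC _| = #|[pred x | x != linv y]|) => [|]; first by lra.
exact: eq_card.
Qed.

Lemma expect_le n f g :
  (forall w, reduced w -> size w = n -> f w <= g w) -> expect n f <= expect n g.
Proof.
move=> fg; rewrite /expect; apply: ler_wpM2l.
  by rewrite invr_ge0 mulr_ge0 ?exprn_ge0 ?ltW ?q_gt0.
rewrite big_seq [leRHS]big_seq ler_sum // => w.
by rewrite mem_words => /andP[rw /eqP]; exact: fg.
Qed.

Lemma expectD n f g : expect n (fun w => f w + g w) = expect n f + expect n g.
Proof. by rewrite /expect big_split mulrDr. Qed.

Lemma expectZ n a f : expect n (fun w => a * f w) = a * expect n f.
Proof. by rewrite /expect -mulr_sumr mulrCA. Qed.

(** Conditioning on the first [n] letters: each of the [q] admissible next letters has conditional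
    probability [1/q]. *)
Lemma expect_rcons n f : (0 < n)%N ->
  expect n.+1 f =
  expect n (fun w => q^-1 * \sum_(x | x != linv (last x0 w)) f (rcons w x)).
Proof.
move=> n0; rewrite /expect -mulr_sumr mulrA /= -[in q ^+ n](prednK n0) exprSr.
congr (_ * _); first by rewrite mulrA [LHS]invfM.
rewrite big_allpairs_dep big_seq [RHS]big_seq; apply: eq_bigr => w.
rewrite mem_words => /andP[rw /eqP wn]; rewrite big_filter big_enum_cond /=.
apply: eq_bigl => x; rewrite reduced_rcons ?rw //.
by apply: contraTneq n0 => w0; rewrite -wn w0.
Qed.

Lemma expect1 n : (0 < n)%N -> expect n (fun=> 1) = 1.
Proof.
case: n => // n _; elim: n => [|n IH].
  rewrite /expect /= cats0 expr0 mulr1 big_map big_filter big_enum_cond /=.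
  rewrite sumr_const card_prod card_ord card_bool.
  by rewrite natrM [_ * 2]mulrC mulVf // mulf_neq0.
rewrite expect_rcons // -[RHS]IH; congr expect; apply/funext => w.
by rewrite sumr_const card_not_linv mulVf // gt_eqF // q_gt0.
Qed.

Lemma expect_cst n (a : R) : (0 < n)%N -> expect n (fun=> a) = a.
Proof. by move=> n0; rewrite -[in LHS](mulr1 a) expectZ expect1 // mulr1. Qed.

Lemma measurable_cylinder (v : seq L) :
  measurable (cylinder v : set (borel_boundary k)).
Proof. by apply: sub_sigma_algebra; exists v. Qed.

Local Open Scope classical_set_scope.

Lemma initial_segment_event n (P : pred (seq L)) :
  [set z : borel_boundary k | P (initial_segment z n)] =
  \big[setU/set0]_(w <- words n | P w) cylinder w.
Proof.
rewrite -bigcup_seq_cond; apply/seteqP; split => [z /= Pz|z [w /= /andP[]]].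
  exists (initial_segment z n) => /=; last by rewrite /cylinder /= size_mkseq.
  by rewrite mem_words initial_segment_reduced size_mkseq eqxx.
rewrite mem_words => /andP[_ /eqP <-] Pw; rewrite /cylinder /= => zw.
by rewrite zw.
Qed.

Lemma measurable_initial_segment n (P : pred (seq L)) :
  measurable [set z : borel_boundary k | P (initial_segment z n)].
Proof.
rewrite initial_segment_event; apply: bigsetU_measurable => w _.
exact: measurable_cylinder.
Qed.

Lemma measure_initial_segment_le n (P : pred (seq L)) : (0 < n)%N ->
  (m [set z | P (initial_segment z n)] <= (expect n (fun w => (P w)%:R))%:E)%E.
Proof.
move=> n0; rewrite initial_segment_event /expect.
have : {subset words n <= [pred w | reduced w && (size w == n)]}.
  by move=> w; rewrite mem_words.
elim: (words n) => [|w s IH] sn; first by rewrite !big_nil measure0 mulr0.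
have {}IH : (m (\big[setU/set0]_(w <- s | P w) cylinder w) <=
    (((2 * k.+1%:R) * q ^+ n.-1)^-1 * \sum_(w <- s) (P w)%:R)%:E)%E.
  by apply: IH => v vs; apply: sn; rewrite inE vs orbT.
rewrite !big_cons; case: ifPn => [Pw|_]; last by rewrite add0r.
have /andP[rw /eqP wn] := sn w (mem_head _ _).
rewrite mulrDr mulr1 EFinD (le_trans (measureU2 _ _ _)) ?leeD //.
- exact: measurable_cylinder.
- by apply: bigsetU_measurable => v _; exact: measurable_cylinder.
- have w0 : w != [::] by apply: contraTneq n0 => w0; rewrite -wn w0.
  by have := @uniform_measureP R k w w0 rw; rewrite wn => <-.
Qed.

(** Borel-Cantelli, since the tail bounds are summable, applied to the countably many thresholds
    [1/(j+1)]. *)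
Lemma ae_negligible_growth (g : seq L -> R) :
  (forall e : R, 0 < e -> exists C : R, forall n, (0 < n)%N ->
    expect n (fun w => (e * n%:R < `|g w|)%R%:R) <= C / n%:R ^+ 2) ->
  {ae m, forall z : borel_boundary k,
    g (initial_segment z n) / n%:R @[n --> \oo] --> (0 : R)}.
Proof.
move=> hg.
(* The shift to length [n.+1] avoids the empty word, where [expect] is not an average. *)
pose E (e : R) n : set (borel_boundary k) :=
  [set z | e * n.+1%:R < `|g (initial_segment z n.+1)|].
have mE e n : measurable (E e n).
  exact: (measurable_initial_segment _ (fun w => e * n.+1%:R < `|g w|)).
have E0 e : 0 < e -> m (lim_sup_set (E e)) = 0%E.
  move=> e0; have [C hC] := hg e e0.
  apply: lim_sup_set_cvg0 => //.
  have C0 : 0 <= C.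
    have := hC 1%N isT; rewrite expr1n divr1; apply: le_trans.
    rewrite -(expect_cst (0 : R) (ltn0Sn 0)).
    by apply: expect_le => w _ _; rewrite ler0n.
  (* A telescoping majorant: [1/t^2 <= 2 (1/t - 1/(t+1))] for [t >= 1]. *)
  have bound n : (m (E e n) <= (2 * C * (n.+1%:R^-1 - n.+2%:R^-1))%:E)%E.
    pose P w := e * n.+1%:R < `|g w|.
    apply: le_trans (measure_initial_segment_le P _) _ => //.
    rewrite lee_fin (le_trans (hC n.+1 _)) //.
    rewrite -[n.+2%:R]natr1; set t : R := n.+1%:R.
    have t1 : 1 <= t by rewrite ler1n.
    rewrite -subr_ge0.
    rewrite (_ : _ - _ = C * (t - 1) / (t ^+ 2 * (t + 1))); last first.
      by field; rewrite !gt_eqF //; lra.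
    by rewrite divr_ge0 ?mulr_ge0 ?exprn_ge0 //; lra.
  have partial n : (\sum_(0 <= i < n) m (E e i) <= (2 * C)%:E)%E.
    apply: (@le_trans _ _ (2 * C * (1 - n.+1%:R^-1))%:E).
      elim: n => [|n IH]; first by rewrite big_nil invr1 subrr mulr0.
      rewrite big_nat_recr //= (le_trans (leeD IH (bound n))) // -EFinD lee_fin.
      by rewrite -mulrDr addrA subrK.
    by rewrite lee_fin ler_piMr ?mulr_ge0 // gerBl invr_ge0.
  apply: (@le_lt_trans _ _ (2 * C)%:E); last exact: ltry.
  apply: lime_le; first exact: is_cvg_nneseries.
  by apply: nearW => n; exact: partial.
have : {ae m, forall z, forall j, ~ lim_sup_set (E j.+1%:R^-1) z}.
  apply: ae_foralln => j; exists (lim_sup_set (E j.+1%:R^-1)); split.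
  - by apply: bigcap_measurable => // n _; exact: bigcup_measurable.
  - exact: E0.
  - by move=> z /= /contrapT.
apply: filterS => z hz; apply/cvgr0Pnorm_le => e e0.
have [N _ /(_ N (leqnn N)) je] := near_infty_natSinv_lt (PosNum e0).
have := hz N; rewrite /lim_sup_set /bigcap /= => /existsNP[p /not_implyP[_ hp]].
exists p.+1 => // n /= pn; case: n pn => // n pn.
rewrite normrM [`|_^-1|]ger0_norm // ler_pdivrMr ?ltr0n //.
apply: le_trans (_ : N.+1%:R^-1 * n.+1%:R <= _); last first.
  by rewrite ler_wpM2r // ltW.
by rewrite leNgt; apply/negP => h; apply: hp; exists n.
Qed.

(** Used with [D] the martingale increment: terms linear in [D] disappear on averaging over the next
    letter. *)
Lemma mean_le_affine (f D : L -> R) (a b : R) y :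
  \sum_(x | x != linv y) D x = 0 ->
  (forall x, x != linv y -> f x <= a + b * D x) ->
  q^-1 * \sum_(x | x != linv y) f x <= a.
Proof.
move=> D0 fD; rewrite mulrC ler_pdivrMr ?q_gt0 //.
apply: le_trans (ler_sum _ fD) _.
rewrite big_split /= -mulr_sumr D0 mulr0 addr0.
by rewrite sumr_const -(card_not_linv y) mulr_natr.
Qed.

(** * Moments of a martingale with bounded increments *)

Section Martingale.
Variables (M : seq L -> R) (B : R).
Hypothesis M_start : forall x, `|M [:: x]| <= B.
Hypothesis M_step : forall w x, w != [::] -> reduced (rcons w x) ->
  `|M (rcons w x) - M w| <= B.
Hypothesis M_mean : forall w, reduced w -> w != [::] ->
  \sum_(x | x != linv (last x0 w)) (M (rcons w x) - M w) = 0.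

Let size_neq0 n w : size w = n.+1 -> w != [::].
Proof. by case: w. Qed.

Let B_ge0 : 0 <= B.
Proof. exact: le_trans (M_start x0). Qed.

Let step2 w x : reduced w -> w != [::] -> x != linv (last x0 w) ->
  (M (rcons w x) - M w) ^+ 2 <= B ^+ 2.
Proof.
move=> rw w0 xw; rewrite -[leLHS]real_normK ?num_real //.
rewrite lerXn2r ?nnegrE ?normr_ge0 ?B_ge0 //.
by apply: M_step => //; rewrite reduced_rcons // rw.
Qed.

Lemma martingale_moment2 n :
  expect n.+1 (fun w => M w ^+ 2) <= n.+1%:R * B ^+ 2.
Proof.
elim: n => [|n IH].
  rewrite mul1r -[leRHS](expect_cst _ (ltn0Sn 0)); apply: expect_le.
  move=> [//|x [|//]] _ _; rewrite -[leLHS]real_normK ?num_real //.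
  by rewrite lerXn2r ?nnegrE ?normr_ge0 ?B_ge0.
have -> : n.+2%:R * B ^+ 2 = n.+1%:R * B ^+ 2 + expect n.+1 (fun=> B ^+ 2).
  by rewrite expect_cst // -[n.+2]addn1 natrD mulrDl mul1r.
rewrite expect_rcons //; apply: le_trans (lerD IH (lexx _)).
rewrite -expectD; apply: expect_le => w rw wn.
have w0 := size_neq0 wn.
apply: (mean_le_affine (b := 2 * M w) (M_mean rw w0)) => x xw.
by have := step2 rw w0 xw; nra.
Qed.

(** Expanding [(a + D)^4], the term [4 a^3 D] has mean zero and the rest is at most
    [8 B^2 a^2 + 3 B^4]. With the second moment bound, one step adds at most [(8 N + 3) B^4], while
    the claimed bound grows by [(8 N + 4) B^4]. *)
Lemma martingale_moment4 n :
  expect n.+1 (fun w => M w ^+ 4) <= 4 * n.+1%:R ^+ 2 * B ^+ 4.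
Proof.
have B4 : 0 <= B ^+ 4 by rewrite -[4%N]/(2 * 2)%N exprM sqr_ge0.
elim: n => [|n IH].
  apply: (@le_trans _ _ (B ^+ 4)); last by rewrite expr1n; lra.
  rewrite -[leRHS](expect_cst _ (ltn0Sn 0)); apply: expect_le.
  move=> [//|x [|//]] _ _; rewrite -[leLHS]ger0_norm; last first.
    by rewrite -[4%N]/(2 * 2)%N exprM sqr_ge0.
  by rewrite normrX lerXn2r ?nnegrE ?normr_ge0 ?B_ge0.
rewrite expect_rcons //.
apply: (@le_trans _ _ (expect n.+1 (fun w =>
    M w ^+ 4 + 8 * B ^+ 2 * M w ^+ 2 + 3 * B ^+ 4))).
  apply: expect_le => w rw wn; have w0 := size_neq0 wn.
  apply: (mean_le_affine (b := 4 * M w ^+ 3) (M_mean rw w0)) => x xw.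
  have := step2 rw w0 xw; set D := _ - _; set a := M w => DB.
  have -> : M (rcons w x) = a + D by rewrite addrC subrK.
  (* AM-GM: 4 a D^3 <= 2 a^2 D^2 + 2 D^4 *)
  have h1 : 0 <= (a * D - D ^+ 2) ^+ 2 by exact: sqr_ge0.
  have h2 : 0 <= a ^+ 2 * (B ^+ 2 - D ^+ 2).
    by rewrite mulr_ge0 ?sqr_ge0 ?subr_ge0.
  have h3 : 0 <= (B ^+ 2 - D ^+ 2) * (B ^+ 2 + D ^+ 2).
    by rewrite mulr_ge0 ?subr_ge0 // addr_ge0 ?sqr_ge0.
  lra.
rewrite 2!expectD expectZ expect_cst //.
have := martingale_moment2 n; rewrite -[n.+2]addn1 natrD; set N : R := n.+1%:R.
have N0 : 0 <= B ^+ 2 by exact: sqr_ge0.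
move: IH; rewrite -/N; set E4 := expect _ _; set E2 := expect _ _ => h4 h2.
have h5 : 8 * B ^+ 2 * E2 <= 8 * N * B ^+ 4.
  rewrite (_ : 8 * N * B ^+ 4 = 8 * B ^+ 2 * (N * B ^+ 2)); last by ring.
  by rewrite ler_wpM2l // mulr_ge0.
have -> : 4 * (N + 1) ^+ 2 * B ^+ 4 =
  4 * N ^+ 2 * B ^+ 4 + 8 * N * B ^+ 4 + 4 * B ^+ 4 by ring.
lra.
Qed.

(** Markov's inequality for the fourth power gives a tail of order [1/n^2]; the second moment would
    only give [1/n], which is not summable. *)
Lemma martingale_growth :
  {ae m, forall z : borel_boundary k,
    M (initial_segment z n) / n%:R @[n --> \oo] --> (0 : R)}.
Proof.
apply: ae_negligible_growth => e e0; exists (4 * B ^+ 4 / e ^+ 4) => -[//|n] _.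
set N : R := n.+1%:R; have N0 : 0 < N by rewrite ltr0n.
apply: (@le_trans _ _ ((e * N) ^- 4 * expect n.+1 (fun w => M w ^+ 4))).
  rewrite -expectZ; apply: expect_le => w _ _.
  have M4 : 0 <= M w ^+ 4 by rewrite -[4%N]/(2 * 2)%N exprM sqr_ge0.
  have eN4 : 0 < (e * N) ^+ 4 by rewrite exprn_gt0 // mulr_gt0.
  case: ltP => [h|_]; last by rewrite mulr_ge0 // invr_ge0 ltW.
  rewrite mulrC ler_pdivlMr // mul1r -[leRHS]ger0_norm // normrX.
  by rewrite lerXn2r ?nnegrE ?normr_ge0 ?mulr_ge0 // ltW.
apply: le_trans (ler_wpM2l _ (martingale_moment4 n)) _.
  by rewrite invr_ge0 exprn_ge0 // mulr_ge0 // ltW.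
rewrite le_eqVlt; apply/orP; left; apply/eqP.
by rewrite -/N; field; rewrite !gt_eqF.
Qed.

End Martingale.

(* Given its first p letters, the word has each of its next t letters forced. *)
Lemma mirrored_expect p J t : (0 < p)%N -> (J <= p)%N -> (t <= J)%N ->
  expect (p + t) (fun w =>
    (all (fun s => nth x0 w (p + s) == linv (nth x0 w (J.-1 - s)))
         (iota 0 t))%:R)
  <= q ^- t.
Proof.
move=> p0 Jp; elim: t => [|t IH] tJ.
  by rewrite expr0 invr1 expect1 // addn0.
have qV : 0 <= q^-1 by rewrite invr_ge0 ltW // q_gt0.
rewrite addnS exprS invfM expect_rcons ?addn_gt0 ?p0 //.
apply: le_trans (ler_wpM2l qV (IH (ltnW tJ))); rewrite -expectZ.
apply: expect_le => w rw wn; apply: ler_wpM2l => //.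
set G := all _ _; pose y := linv (nth x0 w (J.-1 - t)).
apply: (@le_trans _ _ (\sum_(x : L | x == y) G%:R)); last first.
  by rewrite big_pred1_eq.
rewrite big_mkcond [leRHS]big_mkcond ler_sum // => x _.
rewrite -[t.+1]addn1 iotaD add0n all_cat /= andbT.
rewrite !nth_rcons wn ltnn eqxx (_ : (_ < p + t)%N); last by lia.
rewrite -/y (eq_in_all (a2 := fun s =>
  nth x0 w (p + s) == linv (nth x0 w (J.-1 - s)))).
  by rewrite -/G; case: (x == y) => //; rewrite ?andbT ?andbF; case: ifP.
move=> s; rewrite mem_iota add0n => /andP[_ st].
by rewrite !nth_rcons wn ltn_add2l st (_ : (_ < p + t)%N) //; lia.
Qed.

(** An overlap of at least [J] forces the last [J] letters, an event of probability at most [q^-J];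
    this is weakened to the quadratic decay that Borel-Cantelli uses here. *)
Lemma overlap_expect n J : (0 < k)%N -> (0 < n)%N ->
  expect n (fun w => (J <= overlap w)%N%:R) <= 2 / J.+1%:R ^+ 2.
Proof.
move=> k0 n0; have [nJ|Jn] := leqP n (2 * J).
  apply: (@le_trans _ _ (expect n (fun=> 0))); last first.
    by rewrite expect_cst // divr_ge0 // exprn_ge0.
  apply: expect_le => w rw wn; rewrite leqNgt (leq_trans (_ : _ < J)%N) //.
  have w0 : w != [::] by apply: contraTneq n0 => w0; rewrite -wn w0.
  by have := overlap_lt rw w0; lia.
have qJ : q ^- J <= 2 / J.+1%:R ^+ 2.
  have q3 : 3 <= q.
    have k1 : 1 <= k%:R :> R by rewrite ler1n.
    rewrite -[k.+1%:R]natr1; lra.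
  (* The extra 1 lets the induction close: without it the first step would require [4 <= 3]. *)
  have h : J.+1%:R ^+ 2 + 1 <= 2 * q ^+ J.
    elim: (J) => [|i IH]; first by rewrite expr1n expr0; lra.
    apply: (@le_trans _ _ (3 * (2 * q ^+ i))); last first.
      rewrite exprS mulrCA ler_wpM2l // ler_wpM2r // exprn_ge0 //; lra.
    have i0 : 0 <= i%:R :> R by [].
    by move: IH; rewrite -[i.+2%:R]natr1 -[i.+1%:R]natr1; nra.
  rewrite ler_pdivlMr ?exprn_gt0 ?ltr0n // mulrC ler_pdivrMr; last first.
    by rewrite exprn_gt0 //; lra.
  by apply: le_trans h; rewrite lerDl.
apply: le_trans qJ; have -> : n = (n - J + J)%N by lia.
have p0 : (0 < n - J)%N by lia.
have Jp : (J <= n - J)%N by lia.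
apply: le_trans (mirrored_expect p0 Jp (leqnn J)).
apply: expect_le => w rw wn; case: leqP => // Jw.
rewrite (_ : all _ _ = true) //; apply/allP => s.
rewrite mem_iota => /andP[_ sJ].
have /overlap_mirrored : (J.-1 - s < overlap w)%N by lia.
rewrite /mirrored wn -/x0 => /eqP <-; apply/eqP; congr nth; lia.
Qed.

Lemma overlap_growth : (0 < k)%N ->
  {ae m, forall z : borel_boundary k,
    (overlap (initial_segment z n)).+1%:R / n%:R @[n --> \oo] --> (0 : R)}.
Proof.
move=> k0.
apply: (ae_negligible_growth (g := fun w => (overlap w).+1%:R)) => e e0.
exists (2 / e ^+ 2) => n n0; pose J := Num.truncn (e * n%:R).
have n0R : 0 < n%:R :> R by rewrite ltr0n.
have /andP[J1 J2] : J%:R <= e * n%:R < J.+1%:R.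
  by apply: Num.Theory.truncn_itv; rewrite mulr_ge0 // ltW.
apply: (@le_trans _ _ (expect n (fun w => (J <= overlap w)%N%:R))).
  apply: expect_le => w _ _; rewrite ger0_norm //; case: ltP => // h.
  by rewrite -ltnS -(ltr_nat R) (le_lt_trans J1 h).
apply: le_trans (overlap_expect _ k0 n0) _.
rewrite -mulrA -invfM -exprMn ler_wpM2l //.
rewrite lef_pV2 ?posrE ?exprn_gt0 ?mulr_gt0 //.
by rewrite lerXn2r ?nnegrE ?mulr_ge0 // ltW.
Qed.

End Words.

(** * From a bounded potential with constant drift to the stretching factor *)

Section Potential.
Variables (R : realType) (k : nat) (F : groupType) (A : 'I_k.+1 -> F).
Hypotheses (hA : free_basis A) (k0 : (0 < k)%N).
Variables (f f' : {multiplicative F -> F}) (l H : R).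
Variable (h : seq (letter k.+1) -> R).
Hypotheses (fK : cancel f f') (hH : forall w, `|h w| <= H).

Let len_f w : R := (len A (f (word_val A w)))%:R.

Hypothesis drift : forall w, reduced w -> w != [::] ->
  \sum_(x | x != linv (last (ord0, false) w))
    (len_f (rcons w x) + h (rcons w x) - (len_f w + h w) - l) = 0.

Local Open Scope classical_set_scope.

(* By the drift hypothesis, len_f + h - l * size is a martingale along the
   initial segments of a random semi-infinite word. *)
Lemma stretching_factor_of_potential : is_generic_stretching_factor A f l.
Proof.
pose M w : R := len_f w + h w - l * (size w)%:R.
have [K hK] := hom_lipschitz hA f.
have H0 : 0 <= H := le_trans (normr_ge0 _) (hH [::]).
have len_step w x : `|len_f (rcons w x) - len_f w| <= K%:R.
  have le1 : (len A (letter_val A x) <= 1)%N.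
    by have := len_val_le hA [:: x]; rewrite /word_val big_seq1.
  have lex : (len A (f (letter_val A x)) <= K)%N.
    by rewrite (leq_trans (hK _)) // -[leqRHS]muln1 leq_mul2l le1 orbT.
  have e : f (word_val A (rcons w x)) =
      (f (word_val A w) * f (letter_val A x))%g.
    by rewrite word_val_rcons gmulfM.
  have h1 : (len A (f (word_val A (rcons w x))) <=
      len A (f (word_val A w)) + K)%N.
    by rewrite e (leq_trans (lenM hA _ _)) // leq_add2l.
  have h2 : (len A (f (word_val A w)) <=
      len A (f (word_val A (rcons w x))) + K)%N.
    have -> : f (word_val A w) =
        (f (word_val A (rcons w x)) * (f (letter_val A x))^-1)%g.
      by rewrite e mulgK.
    by rewrite (leq_trans (lenM hA _ _)) // lenV // leq_add2l.
  rewrite ler_norml /len_f; move: h1 h2; rewrite -!(ler_nat R) !natrD => h1 h2.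
  by apply/andP; split; lra.
have M_step w x : `|M (rcons w x) - M w| <= K%:R + H + H + `|l|.
  have -> : M (rcons w x) - M w =
    (len_f (rcons w x) - len_f w) + h (rcons w x) + - h w + - l.
    by rewrite /M size_rcons -[(size w).+1%:R]natr1; ring.
  rewrite (le_trans (ler_normD _ _)) // normrN lerD //.
  rewrite (le_trans (ler_normD _ _)) // normrN lerD //.
  by rewrite (le_trans (ler_normD _ _)) // lerD.
have M_growth : {ae uniform_measure R k, forall z : borel_boundary k,
    M (initial_segment z n) / n%:R @[n --> \oo] --> (0 : R)}.
  (* The first four terms bound an increment of [M]; the last one is for the value on one-letter
     words. *)
  apply: (@martingale_growth _ _ _ (K%:R + H + H + `|l| + `|M [::]|)).
  - move=> x; rewrite -[M [:: x]](subrK (M [::])).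
    by rewrite (le_trans (ler_normD _ _)) // lerD // (M_step [::] x).
  - by move=> w x _ _; rewrite (le_trans (M_step w x)) // lerDl.
  - move=> w rw w0; rewrite -[RHS](drift rw w0); apply: eq_bigr => x _.
    by rewrite /M size_rcons -[(size w).+1%:R]natr1; ring.
have [C hC] := cyclic_length_near hA fK.
apply: filterS2 M_growth (overlap_growth R k0) => z Mz oz.
apply/cvgrPdist_le => e e0.
(* A majorant of the distance from the quotient to [l]: [H] accounts for the potential and [C] for
   the passage to cyclic length. Both are multiplied by [(overlap _).+1], which is at least 1. *)
have /cvgrPdist_le/(_ e e0) : `|M (initial_segment z n) / n%:R| +
    (H + C%:R) * ((overlap (initial_segment z n)).+1%:R / n%:R)
    @[n --> \oo] --> (0 : R).
  rewrite -[X in _ --> X]addr0; apply: cvgD.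
    by rewrite -(@normr0 _ R); apply: cvg_norm.
  by rewrite -[X in _ --> X](mulr0 (H + C%:R)); apply: cvgMr.
apply: filterS2 (nbhs_infty_gt 0) => n n0.
rewrite sub0r normrN => /(le_trans (ler_norm _)); apply: le_trans.
set w := initial_segment z n.
have wn : size w = n by rewrite size_mkseq.
have w0 : w != [::] by apply: contraTneq n0 => w0; rewrite -wn w0.
have n0R : 0 < n%:R :> R by rewrite ltr0n.
have h1 := cyclic_length_le A (f (word_val A w)).
have h2 := hC w (initial_segment_reduced _ _) w0.
rewrite normrM [`|_^-1|]ger0_norm ?invr_ge0 // mulrA -mulrDl ler_pdivlMr //.
rewrite -[X in _ * X <= _]ger0_norm // -normrM mulrBl divfK ?gt_eqF //.
have := hH w; rewrite /M /len_f wn.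
move: h1 h2; rewrite -!(ler_nat R) natrD natrM => h1 h2.
set c := (cyclic_length _ _)%:R in h1 h2 *.
set lf := (len _ _)%:R in h1 h2 *; set o := (overlap w).+1%:R in h2 *.
have o1 : 1 <= o by rewrite ler1n.
have Ho : H <= H * o by rewrite ler_peMr.
rewrite !ler_norml => /andP[hw1 hw2].
have C0 : 0 <= C%:R * o by rewrite mulr_ge0.
have a1 := ler_norm (lf + h w - l * n%:R).
have a2 := lerNnormlW (lexx `|lf + h w - l * n%:R|).
by rewrite mulrDl; apply/andP; split; lra.
Qed.

End Potential.

(** * The explicit automorphism, its inverse and their automata *)

Section Machines.
Variables (R : realType) (k : nat) (i j : 'I_k.+1).
Hypothesis ij : i != j.
Notation L := (letter k.+1).
Notation q := (2 * k.+1%:R - 1 : R).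
Notation la := ((i, false) : L).
Notation lA := ((i, true) : L).
Notation lb := ((j, false) : L).
Notation lB := ((j, true) : L).
Implicit Types (x y z : L) (p s w : seq L).

(** All letters of the fixed basis elements share the kind [Ko], so that the automata do not depend
    on the rank. *)
Inductive kind := Ka | KA | Kb | KB | Ko.

Definition kind_of x : kind :=
  if x.1 == i then if x.2 then KA else Ka
  else if x.1 == j then if x.2 then KB else Kb else Ko.

Variant kind_spec : L -> kind -> Prop :=
| Kind_a : kind_spec la Ka
| Kind_A : kind_spec lA KA
| Kind_b : kind_spec lb Kb
| Kind_B : kind_spec lB KB
| Kind_o (c : 'I_k.+1) e of c == i = false & c == j = false :
    kind_spec (c, e) Ko.

Lemma kind_ofP x : kind_spec x (kind_of x).
Proof.
case: x => c e; rewrite /kind_of /=.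
have [->|ci] := eqVneq c i; first by case: e; constructor.
have [->|cj] := eqVneq c j; first by case: e; constructor.
by constructor; apply: negbTE.
Qed.

Definition not_top z s := if s is y :: _ then y != z else true.

Lemma push_not_top x s : not_top (linv x) s -> push s x = x :: s.
Proof. by case: s => //= y s; rewrite linv_eq_sym; case: eqP. Qed.

Let eqE := (xpair_eqE, eqxx, negbTE ij, eq_sym j i).

(* Subtracting the common value of f on the remaining letters removes the number
   of these letters from the formula. *)
Lemma sum_not_linv (f : L -> R) y c :
  (forall x, kind_of x = Ko -> x != linv y -> f x = c) ->
  \sum_(x | x != linv y) f x =
  q * c + \sum_(x <- [:: la; lA; lb; lB] | x != linv y) (f x - c).
Proof.
move=> fc; have -> : \sum_(x | x != linv y) f x =
    \sum_(x | x != linv y) c + \sum_(x | x != linv y) (f x - c).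
  by rewrite -big_split; apply: eq_bigr => x _; rewrite [RHS]addrC subrK.
rewrite sumr_const -(card_not_linv R y) mulr_natl; congr (_ + _).
rewrite (bigID (mem [:: la; lA; lb; lB])) /= [X in _ + X]big1 ?addr0.
  rewrite big_mkcondl -big_uniq ?[RHS]big_mkcond //.
  by rewrite /= !inE !eqE.
move=> x /andP[xy]; rewrite !inE; case: (kind_ofP x) xy; rewrite ?eqE //=.
by move=> d e di dj xy _; rewrite fc ?subrr // /kind_of /= di dj.
Qed.

(* phi : a -> ababa, b -> ba *)
Definition phi_img x := match kind_of x with
  | Ka => [:: la; lb; la; lb; la] | KA => [:: lA; lB; lA; lB; lA]
  | Kb => [:: lb; la] | KB => [:: lA; lB] | Ko => [:: x] end.

(* psi = phi^-1 : a -> a b^-2, b -> b^3 a^-1 *)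
Definition psi_img x := match kind_of x with
  | Ka => [:: la; lB; lB] | KA => [:: lb; lb; lA]
  | Kb => [:: lb; lb; lb; lA] | KB => [:: la; lB; lB; lB] | Ko => [:: x] end.

Arguments push : simpl never.

Let pushE :
  ((forall s, push (la :: s) lA = s) * (forall s, push (lA :: s) la = s) *
   (forall s, push (lb :: s) lB = s) * (forall s, push (lB :: s) lb = s) *
   (forall s, push (la :: s) la = [:: la, la & s]) *
   (forall s, push (lA :: s) lA = [:: lA, lA & s]) *
   (forall s, push (lb :: s) lb = [:: lb, lb & s]) *
   (forall s, push (lB :: s) lB = [:: lB, lB & s]) *
   (forall s, push (la :: s) lb = [:: lb, la & s]) *
   (forall s, push (la :: s) lB = [:: lB, la & s]) *
   (forall s, push (lA :: s) lb = [:: lb, lA & s]) *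
   (forall s, push (lA :: s) lB = [:: lB, lA & s]) *
   (forall s, push (lb :: s) la = [:: la, lb & s]) *
   (forall s, push (lb :: s) lA = [:: lA, lb & s]) *
   (forall s, push (lB :: s) la = [:: la, lB & s]) *
   (forall s, push (lB :: s) lA = [:: lA, lB & s]))%type.
Proof. by do !split; move=> s; rewrite /push /= !eqE. Qed.

Ltac use_distinct := repeat match goal with
  | H : (?c == ?d) = false |- _ => progress rewrite ?H ?(eq_sym d c) ?H
  end.

Ltac decide_letters := rewrite /linv /= ?xpair_eqE /=;
  use_distinct; by rewrite ?eqE.

(** Evaluates nested pushes from the inside, by [pushE] or by checking that no cancellation
    occurs. *)
Ltac run_push := rewrite ?pushE; repeat (match goal with
  | |- context [push ?s ?x] => lazymatch s with
    | context [push _ _] => fail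
    | _ => rewrite (@push_not_top x s);
           last by first [done | rewrite /= linv_eq_sym; done | decide_letters]
    end
  end; rewrite ?pushE).

Let kindE : ((kind_of la = Ka) * (kind_of lA = KA) * (kind_of lb = Kb) *
  (kind_of lB = KB))%type.
Proof. by rewrite /kind_of /= !eqE. Qed.

Lemma q_ge3 : (0 < k)%N -> 3 <= q.
Proof.
move=> k0; have k1 : 1 <= k%:R :> R by rewrite ler1n.
by rewrite -[k.+1%:R]natr1; lra.
Qed.

(* phi_state n y s: the automaton is in state n after reading a word with last
   letter y whose reduced image, written backwards, is s. The letters displayed
   in front of p are those that subsequent letters may cancel. *)
Inductive phi_state : nat -> L -> seq L -> Prop :=
| Phi0 p of not_top lb p : phi_state 0 la [:: la, lb, la, lb, la & p]
| Phi1 p : phi_state 1 lb [:: la, lb, la, lb, la, lb & p]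
| Phi2 p of not_top lb p : phi_state 2 lB [:: la, lb, la & p]
| Phi3 c e p of c == i = false & c == j = false :
    phi_state 3 (c, e) ((c, e) :: p)
| Phi4A p : phi_state 4 lA (lA :: p)
| Phi4b p : phi_state 4 lA (lb :: p)
| Phi5 p of not_top lb p : phi_state 5 lB (la :: p)
| Phi6 p of not_top la p : phi_state 6 lb [:: la, lb & p]
| Phi7 p : phi_state 7 lB (lB :: p)
| Phi8 p of not_top la p : phi_state 8 lb [:: la, lb, la, lb & p].

(** The default 0 is the state after reading [a]; it also fills the entries for a letter following
    its own inverse, which never occur in a reduced word. *)
Definition phi_next (s : nat) (c : kind) : nat :=
  match s, c with
  | _, Ko => 3
  | 0, Kb => 1 | 0, KB => 2
  | 1, KA => 4 | 1, Kb => 1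
  | 2, KA => 4 | 2, KB => 5
  | 3, KA => 4 | 3, Kb => 6 | 3, KB => 7
  | 4, KA => 4 | 4, Kb => 6 | 4, KB => 7
  | 5, KA => 4 | 5, KB => 7
  | 6, KA => 4 | 6, Kb => 8
  | 7, KA => 4 | 7, KB => 7
  | 8, KA => 4 | 8, Kb => 1
  | _, _ => 0
  end%N.

(* The solution of the Poisson equation of the automaton that vanishes in state
   3, with Q in place of 2k - 1. *)
Definition phi_potential (Q : R) : seq R := [::
  (- 6 - 12 * Q - 8 * Q ^+ 2) / (Q * (Q ^+ 2 - 1));
  (2 + 4 * Q - 5 * Q ^+ 2 - 11 * Q ^+ 3) / (Q ^+ 2 * (Q ^+ 2 - 1));
  (6 + 14 * Q + Q ^+ 2 - 11 * Q ^+ 3) / (Q ^+ 2 * (Q ^+ 2 - 1));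
  0;
  (6 + 16 * Q + 8 * Q ^+ 2 - 4 * Q ^+ 3) / (Q ^+ 2 * (Q ^+ 2 - 1));
  (2 + 8 * Q + 5 * Q ^+ 2 - 5 * Q ^+ 3) / (Q ^+ 2 * (Q ^+ 2 - 1));
  (- 2 - 3 * Q - 5 * Q ^+ 2) / (Q * (Q ^+ 2 - 1));
  (2 + 4 * Q + 5 * Q ^+ 2 - Q ^+ 3) / (Q ^+ 2 * (Q ^+ 2 - 1));
  (2 + 2 * Q - 5 * Q ^+ 2 - 9 * Q ^+ 3) / (Q ^+ 2 * (Q ^+ 2 - 1))].

(** The constant of the Poisson equation, that is, the mean growth of the reduced image per letter
    read. *)
Definition phi_factor (Q : R) : R :=
  1 - (8 + 20 * Q + 8 * Q ^+ 2 - 10 * Q ^+ 3) / (Q ^+ 3 * (Q + 1)).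

Lemma phi_state_next n y s x : phi_state n y s -> x != linv y ->
  phi_state (phi_next n (kind_of x)) x (foldl push s (phi_img x)).
Proof.
move=> inv; rewrite /phi_img.
case: (kind_ofP x) => [||||c e ci cj]; case: inv => {n y s};
  rewrite /linv /= ?eqE //; intros.
all: try run_push.
all: by constructor; first [done | decide_letters].
Qed.

(** State 3 can serve as the initial state: a fixed letter on top of the stack blocks cancellation
    with the images of [a] and [b] just as an empty stack does. *)
Lemma phi_state_start x :
  phi_state (phi_next 3 (kind_of x)) x (foldl push [::] (phi_img x)).
Proof.
rewrite /phi_img; case: (kind_ofP x) => [||||c e ci cj] /=; run_push.
all: by constructor; first [done | decide_letters].
Qed.

Lemma phi_state_drift n y s : (0 < k)%N -> phi_state n y s ->
  \sum_(x | x != linv y) ((size (foldl push s (phi_img x)))%:R +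
    (phi_potential q)`_(phi_next n (kind_of x)) -
    ((size s)%:R + (phi_potential q)`_n) - phi_factor q) = 0.
Proof.
(* From here [Q] is any real number at least 3, and the drift equation becomes an identity of
   rational functions in each state. *)
move=> /q_ge3; have := @sum_not_linv; move: (q) => Q sumE Q3 inv.
(* A fixed letter adds exactly one letter to the image and leads to state 3, where the potential
   vanishes; the summand is therefore constant on these letters. *)
have onO x : kind_of x = Ko -> x != linv y ->
    (size (foldl push s (phi_img x)))%:R +
    (phi_potential Q)`_(phi_next n (kind_of x)) -
    ((size s)%:R + (phi_potential Q)`_n) - phi_factor Q =
    1 - (phi_potential Q)`_n - phi_factor Q.
  { have : (phi_potential Q)`_3 = 0 by [].
  move: (phi_potential Q) => t t3.
  rewrite /phi_img; case: (kind_ofP x) => // c e ci cj _.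
  case: inv => {n y s}; intros; rewrite /=; run_push.
  all: rewrite /= -!natr1 t3; move: (size p) => m; ring. }
rewrite (sumE _ _ _ onO) {sumE onO}; case: inv => {n y s}; intros.
all: rewrite !big_cons big_nil /linv /= ?xpair_eqE /=.
all: use_distinct; rewrite ?eqE /=.
all: rewrite /phi_img ?kindE /=.
all: run_push.
all: rewrite /= -?natr1 /phi_potential /phi_factor /=; move: (size p) => m.
all: by field; rewrite !gt_eqF //; nra.
Qed.

(** The conventions are those of [phi_state]. Constructors with the same number are stack shapes
    with the same transitions and the same length increments. *)
Inductive psi_state : nat -> L -> seq L -> Prop :=
| Psi0 p : psi_state 0 la [:: lB, lB, la & p]
| Psi1 p : psi_state 1 lb [:: lA, lb, la & p]
| Psi2 p of not_top la p & not_top lb p : psi_state 2 lB [:: lB, lB & p]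
| Psi3 c e p of c == i = false & c == j = false :
    psi_state 3 (c, e) ((c, e) :: p)
| Psi4 p : psi_state 4 la [:: lB, la & p]
| Psi5 p of not_top la p & not_top lb p & not_top lB p :
    psi_state 5 lA [:: lA, lb, lb & p]
| Psi6a p : psi_state 6 lb [:: lA, lb, lb, la & p]
| Psi6b p : psi_state 6 lb [:: lA, lb, lb, lb & p]
| Psi7 p of not_top la p & not_top lb p : psi_state 7 lA (lA :: p)
| Psi8 p of not_top la p & not_top lb p & not_top lB p :
    psi_state 8 lB (lB :: p)
| Psi9a p : psi_state 9 la (la :: p)
| Psi9b p : psi_state 9 la (lb :: p)
| Psi10 p of not_top la p & not_top lb p & not_top lB p :
    psi_state 10 lA [:: lA, lb & p].

Definition psi_next (s : nat) (c : kind) : nat :=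
  match s, c with
  | _, Ko => 3
  | 0, Kb => 1 | 0, KB => 2
  | 1, Ka => 4 | 1, KA => 5 | 1, Kb => 6
  | 2, KA => 7 | 2, KB => 2
  | 4, Kb => 6 | 4, KB => 2
  | 5, KA => 5 | 5, Kb => 6 | 5, KB => 8
  | 6, Ka => 9 | 6, KA => 5 | 6, Kb => 6
  | 8, KA => 10 | 8, KB => 2
  | _, Ka => 0 | _, KA => 5 | _, Kb => 6 | _, KB => 2
  end%N.

(** The Poisson solution for the second automaton, again normalised to vanish in state 3. *)
Definition psi_potential (Q : R) : seq R := [::
  (2 - 4 * Q + 10 * Q ^+ 2 - 6 * Q ^+ 3) / (Q ^+ 2 * (Q ^+ 2 - 1));
  (- 2 + 6 * Q - 8 * Q ^+ 2 + 9 * Q ^+ 3 - 7 * Q ^+ 4) / (Q ^+ 3 * (Q ^+ 2 - 1));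
  (- 2 + 4 * Q - 6 * Q ^+ 2 + 13 * Q ^+ 3 - 7 * Q ^+ 4) / (Q ^+ 3 * (Q ^+ 2 - 1));
  0;
  (- 2 + 4 * Q - 4 * Q ^+ 2 + 8 * Q ^+ 3 - 4 * Q ^+ 4) / (Q ^+ 3 * (Q ^+ 2 - 1));
  (2 - 4 * Q + 8 * Q ^+ 2 - 8 * Q ^+ 3) / (Q ^+ 2 * (Q ^+ 2 - 1));
  (- 2 + 4 * Q - 6 * Q ^+ 2 + 11 * Q ^+ 3 - 9 * Q ^+ 4) / (Q ^+ 3 * (Q ^+ 2 - 1));
  (- 2 + 4 * Q - 6 * Q ^+ 2 + 6 * Q ^+ 3 - 4 * Q ^+ 4) / (Q ^+ 3 * (Q ^+ 2 - 1));
  (- 2 + 6 * Q - 8 * Q ^+ 2 + 11 * Q ^+ 3 - 5 * Q ^+ 4) / (Q ^+ 3 * (Q ^+ 2 - 1));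
  (- 2 + 4 * Q - 6 * Q ^+ 2 + 8 * Q ^+ 3 - 2 * Q ^+ 4) / (Q ^+ 3 * (Q ^+ 2 - 1));
  (- 2 + 4 * Q - 4 * Q ^+ 2 + 6 * Q ^+ 3 - 6 * Q ^+ 4) / (Q ^+ 3 * (Q ^+ 2 - 1))].

Definition psi_factor (Q : R) : R :=
  1 - (- 4 + 8 * Q - 12 * Q ^+ 2 + 20 * Q ^+ 3 - 10 * Q ^+ 4) / (Q ^+ 4 * (Q + 1)).

Lemma psi_state_next n y s x : psi_state n y s -> x != linv y ->
  psi_state (psi_next n (kind_of x)) x (foldl push s (psi_img x)).
Proof.
move=> inv; rewrite /psi_img.
case: (kind_ofP x) => [||||c e ci cj]; case: inv => {n y s};
  rewrite /linv /= ?eqE //; intros.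
all: try run_push.
all: by constructor; first [done | decide_letters].
Qed.

Lemma psi_state_start x :
  psi_state (psi_next 3 (kind_of x)) x (foldl push [::] (psi_img x)).
Proof.
rewrite /psi_img; case: (kind_ofP x) => [||||c e ci cj] /=; run_push.
all: by constructor; first [done | decide_letters].
Qed.

Lemma psi_state_drift n y s : (0 < k)%N -> psi_state n y s ->
  \sum_(x | x != linv y) ((size (foldl push s (psi_img x)))%:R +
    (psi_potential q)`_(psi_next n (kind_of x)) -
    ((size s)%:R + (psi_potential q)`_n) - psi_factor q) = 0.
Proof.
move=> /q_ge3; have := @sum_not_linv; move: (q) => Q sumE Q3 inv.
have onO x : kind_of x = Ko -> x != linv y ->
    (size (foldl push s (psi_img x)))%:R +
    (psi_potential Q)`_(psi_next n (kind_of x)) -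
    ((size s)%:R + (psi_potential Q)`_n) - psi_factor Q =
    1 - (psi_potential Q)`_n - psi_factor Q.
  { have : (psi_potential Q)`_3 = 0 by [].
  move: (psi_potential Q) => t t3.
  rewrite /psi_img; case: (kind_ofP x) => // c e ci cj _.
  case: inv => {n y s}; intros; rewrite /=; run_push.
  all: rewrite /= -!natr1 t3; move: (size p) => m; ring. }
rewrite (sumE _ _ _ onO) {sumE onO}; case: inv => {n y s}; intros.
all: rewrite !big_cons big_nil /linv /= ?xpair_eqE /=.
all: use_distinct; rewrite ?eqE /=.
all: rewrite /psi_img ?kindE /=.
all: run_push.
all: rewrite /= -?natr1 /psi_potential /psi_factor /=; move: (size p) => m.
all: by field; rewrite !gt_eqF //; nra.
Qed.

(** A finite computation, which through [substitution_cancel] makes [psi] a left inverse of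
    [phi]. *)
Lemma stack_psi_phi x : stack psi_img (phi_img x) = [:: x].
Proof.
by rewrite /stack /phi_img; case: (kind_ofP x) => [||||c e ci cj];
  rewrite /psi_img /= ?kindE /kind_of /= ?ci ?cj /=; run_push.
Qed.

Lemma stack_phi_psi x : stack phi_img (psi_img x) = [:: x].
Proof.
by rewrite /stack /psi_img; case: (kind_ofP x) => [||||c e ci cj];
  rewrite /phi_img /= ?kindE /kind_of /= ?ci ?cj /=; run_push.
Qed.

Lemma phi_img_linv x : phi_img (linv x) = winv (phi_img x).
Proof.
by rewrite /phi_img; case: (kind_ofP x) => [||||c e ci cj];
  rewrite /linv /= ?kindE ?/kind_of /= ?ci ?cj.
Qed.

Lemma psi_img_linv x : psi_img (linv x) = winv (psi_img x).
Proof.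
by rewrite /psi_img; case: (kind_ofP x) => [||||c e ci cj];
  rewrite /linv /= ?kindE ?/kind_of /= ?ci ?cj.
Qed.

End Machines.

(** * Stretching factor read off from an automaton *)

Section MachineStretching.
Variables (R : realType) (k : nat) (F : groupType) (A : 'I_k.+1 -> F).
Hypotheses (hA : free_basis A) (k0 : (0 < k)%N).
Notation L := (letter k.+1).
Variables (f f' : {multiplicative F -> F}) (img : L -> seq L).
Hypotheses (fK : cancel f f')
  (fimg : forall x, f (letter_val A x) = word_val A (img x)).
Variables (state : nat) (next : nat -> L -> nat).
Variable (inv : nat -> L -> seq L -> Prop).
Variables (t : seq R) (l : R).
Hypotheses
  (inv_start : forall x, inv (next state x) x (foldl push [::] (img x)))
  (inv_next : forall n y s x, inv n y s -> x != linv y ->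
    inv (next n x) x (foldl push s (img x)))
  (inv_drift : forall n y s, inv n y s ->
    \sum_(x | x != linv y) ((size (foldl push s (img x)))%:R +
      t`_(next n x) - ((size s)%:R + t`_n) - l) = 0).

Lemma stretching_factor_of_machine : is_generic_stretching_factor A f l.
Proof.
pose st w := foldl next state w.
have inv_st w : reduced w -> w != [::] ->
    inv (st w) (last (ord0, false) w) (stack img w).
  elim/last_ind: w => // w x IH.
  have [->|w0] := eqVneq w [::]; first by move=> _ _; exact: inv_start.
  rewrite reduced_rcons // /st foldl_rcons stack_rcons last_rcons.
  move=> /andP[rw xw] _.
  exact: inv_next (IH rw w0) xw.
(* The potential of a word depends only on the state reached. The sum of absolute values bounds
   every entry of [t], as well as the default 0 outside the table. *)
apply: (stretching_factor_of_potential (h := fun w => t`_(st w))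
  (H := \sum_(y <- t) `|y|) hA k0 fK) => [w|w rw w0].
  have [tw|/(mem_nth 0)] := leqP (size t) (st w).
    by rewrite nth_default // normr0 sumr_ge0.
  move: (t`_(st w)) => y; elim: (t) => // z u IH.
  rewrite inE big_cons => /orP[/eqP->|/IH].
    by rewrite lerDl sumr_ge0.
  by move/le_trans; apply; rewrite lerDr.
rewrite -[RHS](inv_drift (inv_st w rw w0)); apply: eq_bigr => x _.
by rewrite !(len_stack hA fimg) stack_rcons /st foldl_rcons.
Qed.

End MachineStretching.

(** * Endomorphisms defined by substituting words for letters *)

Section Substitution.
Variables (k : nat) (F : groupType) (A : 'I_k.+1 -> F).
Hypothesis hA : free_basis A.
Notation L := (letter k.+1).
Implicit Types (img : L -> seq L).

Lemma substitution img : (forall x, img (linv x) = winv (img x)) ->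
  exists f : {multiplicative F -> F},
    forall x, f (letter_val A x) = word_val A (img x).
Proof.
move=> img_linv.
have [f fA _] := free_basis_lift (fun c => word_val A (img (c, false))) hA.
exists f => -[c []]; rewrite /letter_val /= ?fA //.
by rewrite homV fA -[(c, true)]/(linv (c, false)) img_linv val_winv.
Qed.

Lemma substitution_cancel img img' (f f' : {multiplicative F -> F}) :
  (forall x, f (letter_val A x) = word_val A (img x)) ->
  (forall x, f' (letter_val A x) = word_val A (img' x)) ->
  (forall x, stack img' (img x) = [:: x]) -> cancel f f'.
Proof.
move=> fimg fimg' imgK g; have [w _ [<- _]] := word_of hA g.
elim: w => [|x w IH]; first by rewrite word_val_nil !hom1.
rewrite word_val_cons !gmulfM IH fimg -(val_stack fimg') imgK; congr (_ * _)%g.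
by rewrite /word_val big_seq1.
Qed.

End Substitution.

(** * Comparison of the two factors and conclusion *)

Lemma phi_factor_neq_psi_factor (R : realType) (Q : R) :
  3 <= Q -> phi_factor Q <> psi_factor Q.
Proof.
move=> Q3; suff : psi_factor Q - phi_factor Q < 0.
  by move=> + e; rewrite e subrr ltxx.
have -> : psi_factor Q - phi_factor Q =
    - (4 * (3 * Q ^+ 3 - 8 * Q ^+ 2 - 1) / (Q ^+ 4 * (Q + 1))).
  by rewrite /phi_factor /psi_factor; field; rewrite !gt_eqF //; lra.
rewrite oppr_lt0 divr_gt0 //; last by rewrite mulr_gt0 ?exprn_gt0 //; lra.
(* For [Q >= 3] one has [Q^2 (3 Q - 8) >= 9 > 1]. *)
by rewrite mulr_gt0 //; nra.
Qed.

Theorem corollary8p8 (R : realType) (k : nat) (hk : (2 <= k.+1)%N)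
    (F : groupType) (A : 'I_k.+1 -> F) (hA : free_basis A) :
  exists (phi phi_inv : {multiplicative F -> F}) (l l_inv : R),
    [/\ cancel phi phi_inv, cancel phi_inv phi,
        is_generic_stretching_factor A phi l,
        is_generic_stretching_factor A phi_inv l_inv
      & l <> l_inv].
Proof.
(* The first and the last basis elements play the roles of [a] and [b]; they differ because the rank
   is at least 2. *)
have ij : (ord0 : 'I_k.+1) != ord_max by rewrite -val_eqE /= eq_sym -lt0n.
have [f fimg] := substitution hA (phi_img_linv ij).
have [f' fimg'] := substitution hA (psi_img_linv ij).
have fK := substitution_cancel hA fimg fimg' (stack_psi_phi ij).
have f'K := substitution_cancel hA fimg' fimg (stack_phi_psi ij).
pose Q : R := 2 * k.+1%:R - 1.
exists f, f', (phi_factor Q), (psi_factor Q); split=> //.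
- apply: (stretching_factor_of_machine (state := 3%N)
    (next := fun s x => phi_next s (kind_of ord0 ord_max x))
    (inv := @phi_state k ord0 ord_max) (t := phi_potential Q) hA hk fK fimg).
  + exact: phi_state_start.
  + exact: phi_state_next.
  + by move=> n y s; exact: phi_state_drift.
- apply: (stretching_factor_of_machine (state := 3%N)
    (next := fun s x => psi_next s (kind_of ord0 ord_max x))
    (inv := @psi_state k ord0 ord_max) (t := psi_potential Q) hA hk f'K fimg').
  + exact: psi_state_start.
  + exact: psi_state_next.
  + by move=> n y s; exact: psi_state_drift.
- exact/phi_factor_neq_psi_factor/q_ge3.
Qed.
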